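(* From a name of a meromorphic function $f$ and a name of a closed set $C\subseteq\mathrm{dom}(f)$, one can uniformly compute a name of the closed set $f[C]$.
   Context: Computability is in the sense of Type-Two Effectivity. $\hat{\mathbb{C}}=\mathbb{C}\cup\{\infty\}$, and $D_r(z)$ is the open disk of radius $r$ centered at $z$. The basic open sets are the open rectangles whose vertices have rational coordinates, together with the sets $\hat{\mathbb{C}}\setminus\overline{D_r(0)}$ with $r$ rational. Names: - A name of a point $z\in\hat{\mathbb{C}}$ is a list of all basic open sets containing $z$. - A name of a closed set $C\subseteq\hat{\mathbb{C}}$ is a list of all basic open sets meeting $C$. - A name of a partial function $f:\subseteq\hat{\mathbb{C}}\to\hat{\mathbb{C}}$ is an oracle $X\subseteq\mathbb{N}$ together with a code of an oracle Turing machine with one-way output tape. With oracle $X$, this machine converts every name of every $z\in\mathrm{dom}(f)$ into a name of $f(z)$. - ''Uniformly computable'' means a single Turing machine, given names of the data, writes a name of the output. A meromorphic function is one meromorphic on an open subset of $\hat{\mathbb{C}}$, with values in $\hat{\mathbb{C}}$. *)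

(* Defs.v *)
From Stdlib Require Import Reals QArith Qreals List Arith.
From Coquelicot Require Import Coquelicot.
Import ListNotations.

Open Scope R_scope.

(* Coding of natural numbers: Cantor (diagonal) unpairing, a bijection *)
(* nat -> nat * nat.                                                   *)
Fixpoint unpair (n : nat) : nat * nat :=
  match n with
  | O => (O, O)
  | S n' => let (x, y) := unpair n' in
            match x with
            | O => (S y, O)
            | S x' => (x', S y)
            end
  end.

(* nat -> Z bijection: 0,1,2,3,4,... |-> 0,-1,1,-2,2,... *)
Definition z_of_nat (n : nat) : Z :=
  if Nat.even n then Z.of_nat (Nat.div2 n) else (- Z.of_nat (Nat.div2 n + 1))%Z.

Definition q_of_nat (n : nat) : Q :=
  let (a, b) := unpair n in Qmake (z_of_nat a) (Pos.of_succ_nat b).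

(* The Riemann sphere: None is the point at infinity.                  *)
Definition Chat := option C.

(* Basic open sets, coded by natural numbers.
   code n with unpair n = (0, m): the open rectangle (a,b) x (c,d) with
   rational a,b,c,d decoded from m (empty if a >= b or c >= d);
   code n with unpair n = (S _, m): Chat \ closure(D_r(0)) with r rational
   decoded from m. *)
Definition rect (m : nat) (z : Chat) : Prop :=
  let (m1, m2) := unpair m in
  let (a, b) := unpair m1 in
  let (c, d) := unpair m2 in
  match z with
  | None => False
  | Some w => Q2R (q_of_nat a) < fst w < Q2R (q_of_nat b) /\
              Q2R (q_of_nat c) < snd w < Q2R (q_of_nat d)
  end.

(* complement of the closure of the open disk D_r(0) (D_r(0) is empty,
   hence so is its closure, when r <= 0) *)
Definition ext (m : nat) (z : Chat) : Prop :=
  let r := Q2R (q_of_nat m) in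
  match z with
  | None => True
  | Some w => r <= 0 \/ r < Cmod w
  end.

Definition basic (n : nat) (z : Chat) : Prop :=
  let (k, m) := unpair n in
  match k with
  | O => rect m z
  | S _ => ext m z
  end.

Definition openS (U : Chat -> Prop) : Prop :=
  forall z, U z -> exists n, basic n z /\ forall w, basic n w -> U w.

Definition closedS (A : Chat -> Prop) : Prop := openS (fun z => ~ A z).

Definition image (f : Chat -> Chat) (A : Chat -> Prop) : Chat -> Prop :=
  fun w => exists z, A z /\ f z = w.

Definition chart (a : Chat) (w : Chat) : C :=
  match a with
  | Some _ => match w with Some x => x | None => RtoC 0 end
  | None => match w with Some x => Cinv x | None => RtoC 0 end
  end.

Definition unchart (a : Chat) (x : C) : Chat :=
  match a with
  | Some _ => Some x
  | None =>
      if Req_EM_T (fst x) 0 then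
        (if Req_EM_T (snd x) 0 then None else Some (Cinv x))
      else Some (Cinv x)
  end.

Definition cont_at_within (U : Chat -> Prop) (f : Chat -> Chat) (z0 : Chat) : Prop :=
  forall n, basic n (f z0) ->
  exists n', basic n' z0 /\ forall w, basic n' w -> U w -> basic n (f w).

Definition holo_at_chart (U : Chat -> Prop) (f : Chat -> Chat) (z0 : Chat) : Prop :=
  let g := fun x : C => chart (f z0) (f (unchart z0 x)) in
  let x0 := chart z0 z0 in
  exists l : C, forall eps : R, 0 < eps -> exists delta : R, 0 < delta /\
    forall x : C, 0 < Cmod (Cminus x x0) < delta -> U (unchart z0 x) ->
      Cmod (Cminus (Cdiv (Cminus (g x) (g x0)) (Cminus x x0)) l) < eps.

(* f : U -> Chat is meromorphic on the open set U: it is a holomorphic map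
   into the Riemann sphere whose poles (points mapped to infinity) are
   isolated in U. *)
Definition meromorphic (U : Chat -> Prop) (f : Chat -> Chat) : Prop :=
  openS U /\
  forall z0, U z0 ->
    cont_at_within U f z0 /\
    holo_at_chart U f z0 /\
    exists n, basic n z0 /\ forall w, basic n w -> U w -> w <> z0 -> f w <> None.

(* Names.  A "list" of natural numbers is a stream p : nat -> nat, in   *)
(* which p i = 0 is a padding symbol and p i = S k lists the code k    *)
(* (this allows empty lists).  p lists exactly the set S of codes.     *)
Definition lists (S : nat -> Prop) (p : nat -> nat) : Prop :=
  forall k, S k <-> exists i, p i = Datatypes.S k.

Definition point_name (z : Chat) (p : nat -> nat) : Prop :=
  lists (fun k => basic k z) p.

Definition closed_name (A : Chat -> Prop) (p : nat -> nat) : Prop :=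
  lists (fun k => exists z, A z /\ basic k z) p.

Local Close Scope R_scope.
Local Open Scope nat_scope.

Inductive instr : Type :=
| Inc (r : nat)
| JZDec (r : nat) (j : nat)
| Query (r : nat)
| Out (r : nat).

Definition prog := list instr.

Record config := mkConfig { pc : nat; regs : nat -> nat }.

Definition upd (g : nat -> nat) (r v : nat) : nat -> nat :=
  fun i => if Nat.eqb i r then v else g i.

Definition step (phi : nat -> nat) (P : prog) (c : config) : option (config * option nat) :=
  match nth_error P (pc c) with
  | None => None
  | Some (Inc r) => Some (mkConfig (S (pc c)) (upd (regs c) r (S (regs c r))), None)
  | Some (JZDec r j) =>
      if Nat.eqb (regs c r) 0 then Some (mkConfig j (regs c), None)
      else Some (mkConfig (S (pc c)) (upd (regs c) r (pred (regs c r))), None)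
  | Some (Query r) => Some (mkConfig (S (pc c)) (upd (regs c) r (phi (regs c r))), None)
  | Some (Out r) => Some (mkConfig (S (pc c)) (regs c), Some (regs c r))
  end.

Fixpoint run (phi : nat -> nat) (P : prog) (n : nat) : config * list nat :=
  match n with
  | O => (mkConfig 0 (fun _ => 0), [])
  | S n' =>
      let (c, o) := run phi P n' in
      match step phi P c with
      | None => (c, o)
      | Some (c', None) => (c', o)
      | Some (c', Some v) => (c', o ++ [v])
      end
  end.

Definition computes (P : prog) (phi : nat -> nat) (q : nat -> nat) : Prop :=
  forall k, exists n, nth_error (snd (run phi P n)) k = Some (q k).

(* Coding of machines by natural numbers (surjective). *)
Definition instr_of_nat (a : nat) : instr :=
  let (k, m) := unpair a in
  match k with
  | O => Inc m
  | 1 => Query m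
  | 2 => Out m
  | _ => let (r, j) := unpair m in JZDec r j
  end.

Fixpoint prog_of_nat_aux (fuel n : nat) : prog :=
  match fuel, n with
  | O, _ => []
  | _, O => []
  | S f, S m => let (a, b) := unpair m in instr_of_nat a :: prog_of_nat_aux f b
  end.

Definition prog_of_nat (e : nat) : prog := prog_of_nat_aux e e.

Definition join (a b : nat -> nat) : nat -> nat :=
  fun n => if Nat.even n then a (Nat.div2 n) else b (Nat.div2 n).

Definition char (X : nat -> bool) : nat -> nat := fun n => if X n then 1%nat else 0%nat.

Definition fun_name (U : Chat -> Prop) (f : Chat -> Chat) (X : nat -> bool) (e : nat) : Prop :=
  forall z p, U z -> point_name z p ->
    exists q, computes (prog_of_nat e) (join (char X) p) q /\ point_name (f z) q.

(* Main.v *)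
(** The image [f[A]] meets the basic set [v] iff some [z] in [A] has a name on which the
    machine of [f] prints [v].  That happens after finitely many steps, hence on a finite
    prefix of the name, and a finite list [s] of codes is a prefix of a name of some point
    of [A] as soon as a basic set meeting [A] is contained in all members of [s];
    conversely, basic sets shrinking to [z] are eventually contained in all members of a
    prefix of a name of [z].  This inclusion is a decidable condition on rational numbers.
    So the output machine enumerates all triples (position in the name of [A], list [s],
    number of steps [t]) and simulates [t] steps of the machine of [f] on [s] padded with
    zeros, which are neutral in names; every round is primitive recursive, so no search is
    needed.  That [f[A]] is closed follows from compactness of the sphere. *)

Require Import Defs.
From Stdlib Require Import Reals ZArith QArith Qreals List Arith Lia Lra Psatz.
From Stdlib Require Import FunctionalExtensionality ClassicalEpsilon.
From Coquelicot Require Import Coquelicot.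
Import ListNotations.

Local Open Scope nat_scope.

(** * Structured programming on the register machine *)

(** The machine [e] of [f] is part of the data while the output machine is one fixed program, so a
    universal simulator is needed on a register machine with absolute jumps. It is never written
    out: closure lemmas show that functions built by composition and primitive recursion relative to
    the oracle can be evaluated, and the simulator is given as such a function.

    Simulating on a padded list instead of a genuine name is legitimate because [t] steps read
    finitely many oracle cells. The run may read past [s], but zeros list nothing, so the cells read
    can be continued to a name of any point lying in all members of [s].

    The inclusion test may reject true inclusions. It suffices that it never accepts a false one,
    and that for finitely many basic sets containing a point some basic neighbourhood of that point
    passes the test against all of them.

    A name of a set lists only what meets it, which does not distinguish a set from its closure;
    closedness of [f[A]] is therefore a separate topological argument. *)

Inductive steps (phi : nat -> nat) (P : prog) : config -> list nat -> config -> Prop :=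
| steps_refl c : steps phi P c [] c
| steps_silent c c1 l c' :
    step phi P c = Some (c1, None) -> steps phi P c1 l c' -> steps phi P c l c'
| steps_out c c1 v l c' :
    step phi P c = Some (c1, Some v) -> steps phi P c1 l c' -> steps phi P c (v :: l) c'.

Lemma steps_trans phi P c1 l1 c2 l2 c3 :
  steps phi P c1 l1 c2 -> steps phi P c2 l2 c3 -> steps phi P c1 (l1 ++ l2) c3.
Proof.
  induction 1; intros H2; simpl; auto.
  - eapply steps_silent; eauto.
  - eapply steps_out; eauto.
Qed.

Lemma run_steps phi P c l c' : steps phi P c l c' ->
  forall n o, run phi P n = (c, o) -> exists m, run phi P m = (c', o ++ l).
Proof.
  induction 1; intros n o E.
  - exists n. now rewrite app_nil_r.
  - apply (IHsteps (S n)). simpl. now rewrite E, H.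
  - destruct (IHsteps (S n) (o ++ [v])) as [m Em].
    + simpl. now rewrite E, H.
    + exists m. now rewrite Em, <- app_assoc.
Qed.

Definition code_at (P : prog) (o : nat) (code : prog) : Prop :=
  forall i ins, nth_error code i = Some ins -> nth_error P (o + i) = Some ins.

Lemma code_at_app P o a b :
  code_at P o (a ++ b) -> code_at P o a /\ code_at P (o + length a) b.
Proof.
  intros H; split; intros i ins E.
  - apply H. rewrite nth_error_app1; auto.
    apply nth_error_Some. congruence.
  - rewrite <- Nat.add_assoc. apply H.
    rewrite nth_error_app2 by lia. now rewrite Nat.add_comm, Nat.add_sub.
Qed.

Lemma code_at_cons P o i b :
  code_at P o (i :: b) -> nth_error P o = Some i /\ code_at P (S o) b.
Proof.
  intros H; split.
  - specialize (H 0 i eq_refl). now rewrite Nat.add_0_r in H.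
  - intros j ins E. specialize (H (S j) ins E). now rewrite Nat.add_succ_r in H.
Qed.

Definition regrel := (nat -> nat) -> (nat -> nat) -> (nat -> nat) -> Prop.

(** Code is produced for each address [o] because the targets of [JZDec] are absolute. [R] occurs as
    a hypothesis, so it also carries preconditions, such as a register being 0, and smaller
    relations are easier to realize. *)
Definition realizable (R : regrel) : Prop :=
  forall o, exists code, forall phi P, code_at P o code ->
  forall g g', R phi g g' ->
  steps phi P (mkConfig o g) [] (mkConfig (o + length code) g').

Lemma realizable_sub (R R' : regrel) :
  (forall phi g g', R' phi g g' -> R phi g g') -> realizable R -> realizable R'.
Proof.
  intros HR H o. destruct (H o) as [code Hc]. exists code. eauto.
Qed.

Lemma realizable_skip : realizable (fun _ g g' => g' = g).
Proof.
  intros o. exists []. intros phi P _ g g' ->. simpl. rewrite Nat.add_0_r. constructor.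
Qed.

Lemma realizable_inc r : realizable (fun _ g g' => g' = upd g r (S (g r))).
Proof.
  intros o. exists [Inc r]. intros phi P H g g' ->.
  apply code_at_cons in H as [H _].
  eapply steps_silent; [|simpl; rewrite Nat.add_1_r; constructor].
  unfold step; simpl. now rewrite H.
Qed.

Lemma realizable_query r : realizable (fun phi g g' => g' = upd g r (phi (g r))).
Proof.
  intros o. exists [Query r]. intros phi P H g g' ->.
  apply code_at_cons in H as [H _].
  eapply steps_silent; [|simpl; rewrite Nat.add_1_r; constructor].
  unfold step; simpl. now rewrite H.
Qed.

Lemma realizable_seq (R1 R2 : regrel) :
  realizable R1 -> realizable R2 ->
  realizable (fun phi g g' => exists g1, R1 phi g g1 /\ R2 phi g1 g').
Proof.
  intros H1 H2 o. destruct (H1 o) as [c1 Hc1]. destruct (H2 (o + length c1)) as [c2 Hc2].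
  exists (c1 ++ c2). intros phi P H g g' (g1 & E1 & E2).
  apply code_at_app in H as [Ha Hb].
  rewrite length_app, Nat.add_assoc.
  change (@nil nat) with (@nil nat ++ @nil nat). eapply steps_trans; eauto.
Qed.

Lemma step_jz_zero phi P o g r j :
  nth_error P o = Some (JZDec r j) -> g r = 0 ->
  step phi P (mkConfig o g) = Some (mkConfig j g, None).
Proof. intros H E. unfold step; simpl. now rewrite H, E. Qed.

Lemma step_jz_succ phi P o g r j v :
  nth_error P o = Some (JZDec r j) -> g r = S v ->
  step phi P (mkConfig o g) = Some (mkConfig (S o) (upd g r v), None).
Proof. intros H E. unfold step; simpl. now rewrite H, E. Qed.

(* In loops and conditionals [z] is a register holding 0, so that [JZDec z]
   is an unconditional jump. *)
Inductive loop_rel (r z : nat) (R : regrel) (phi : nat -> nat) :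
  (nat -> nat) -> (nat -> nat) -> Prop :=
| loop_done g : g r = 0 -> loop_rel r z R phi g g
| loop_next g v g1 g' :
    g r = S v -> R phi (upd g r v) g1 -> g1 z = 0 ->
    loop_rel r z R phi g1 g' -> loop_rel r z R phi g g'.

Lemma realizable_loop r z R : realizable R -> realizable (loop_rel r z R).
Proof.
  intros H o. destruct (H (S o)) as [b Hb].
  exists (JZDec r (o + (length b + 2)) :: b ++ [JZDec z o]).
  intros phi P Hc g g' HR.
  apply code_at_cons in Hc as [H0 Hc]. apply code_at_app in Hc as [H1 Hc].
  apply code_at_cons in Hc as [H2 _].
  replace (o + length (JZDec r (o + (length b + 2)) :: b ++ [JZDec z o]))
    with (o + (length b + 2)) by (simpl; rewrite length_app; simpl; lia).
  induction HR as [g E | g v g1 g' E HR Ez _ IH].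
  - eapply steps_silent; [eapply step_jz_zero; eauto | constructor].
  - eapply steps_silent; [eapply step_jz_succ; eauto |].
    change (@nil nat) with (@nil nat ++ @nil nat).
    eapply steps_trans; [apply Hb; eauto |].
    eapply steps_silent; [eapply step_jz_zero; eauto | exact IH].
Qed.

Lemma realizable_if r z (R1 R2 : regrel) :
  realizable R1 -> realizable R2 ->
  realizable (fun phi g g' =>
    (g r = 0 /\ R2 phi g g') \/
    (exists v, g r = S v /\ R1 phi (upd g r v) g' /\ g' z = 0)).
Proof.
  intros H1 H2 o. destruct (H1 (S o)) as [c1 Hc1].
  destruct (H2 (o + (length c1 + 2))) as [c2 Hc2].
  exists (JZDec r (o + (length c1 + 2)) :: c1 ++
          JZDec z (o + (length c1 + 2 + length c2)) :: c2).
  intros phi P Hc g g' HR.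
  apply code_at_cons in Hc as [A0 Hc]. apply code_at_app in Hc as [A1 Hc].
  apply code_at_cons in Hc as [A2 A3].
  match goal with |- steps _ _ _ _ (mkConfig ?e _) =>
    replace e with (o + (length c1 + 2) + length c2)
      by (simpl; rewrite length_app; simpl; lia) end.
  replace (S (S o + length c1)) with (o + (length c1 + 2)) in A3 by lia.
  destruct HR as [[E HR] | (v & E & HR & Ez)].
  - eapply steps_silent; [eapply step_jz_zero; eauto | eauto].
  - eapply steps_silent; [eapply step_jz_succ; eauto |].
    change (@nil nat) with (@nil nat ++ @nil nat).
    eapply steps_trans; [apply Hc1; eauto |].
    eapply steps_silent; [eapply step_jz_zero; eauto |].
    rewrite Nat.add_assoc. constructor.
Qed.

Lemma upd_same g r v : upd g r v r = v.
Proof. unfold upd. now rewrite Nat.eqb_refl. Qed.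

Lemma upd_other g r v i : i <> r -> upd g r v i = g i.
Proof. unfold upd. destruct (Nat.eqb_spec i r); congruence. Qed.

Ltac updv :=
  repeat (rewrite upd_same || (rewrite upd_other by lia));
  repeat match goal with H : context [upd _ ?r _ ?r] |- _ => rewrite upd_same in H end.

Ltac updf :=
  apply functional_extensionality; intro; unfold upd;
  repeat match goal with
  | |- context [Nat.eqb ?a ?b] => destruct (Nat.eqb_spec a b); subst
  end; try lia; auto.

Lemma realizable_move r s z : r <> s -> r <> z -> s <> z ->
  realizable (fun _ g g' => g z = 0 /\ g' = upd (upd g s (g s + g r)) r 0).
Proof.
  intros D1 D2 D3. eapply realizable_sub; [| exact (realizable_loop r z _ (realizable_inc s))].
  intros phi g g' [Ez ->]. remember (g r) as n eqn:En. symmetry in En.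
  revert g Ez En. induction n as [|n IH]; intros g Ez En.
  - replace (upd (upd g s (g s + 0)) r 0) with g by updf. now constructor.
  - eapply loop_next; [exact En | reflexivity | updv; exact Ez |].
    match goal with |- loop_rel _ _ _ _ ?h _ => set (g1 := h) end.
    replace (upd (upd g s (g s + S n)) r 0) with (upd (upd g1 s (g1 s + n)) r 0)
      by (unfold g1; updf).
    apply IH; unfold g1; updv; auto.
Qed.

Lemma realizable_clear r z : r <> z ->
  realizable (fun _ g g' => g z = 0 /\ g' = upd g r 0).
Proof.
  intros D. eapply realizable_sub; [| exact (realizable_loop r z _ realizable_skip)].
  intros phi g g' [Ez ->]. remember (g r) as n eqn:En. symmetry in En.
  revert g Ez En. induction n as [|n IH]; intros g Ez En.
  - replace (upd g r 0) with g by updf. now constructor.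
  - eapply loop_next; [exact En | reflexivity | updv; exact Ez |].
    replace (upd g r 0) with (upd (upd g r n) r 0) by updf.
    apply IH; updv; auto.
Qed.

(** * Evaluating expressions into a scratch register *)

Definition zero_from (k : nat) (g : nat -> nat) : Prop := forall r, k <= r -> g r = 0.

(* Registers below [k] hold variables, those from [k] on are scratch space; the
   value of [F] is left in register [k]. *)
Definition expressible (k : nat) (F : (nat -> nat) -> (nat -> nat) -> nat) : Prop :=
  realizable (fun phi g g' => zero_from k g /\ g' = upd g k (F phi g)).

Lemma expressible_ext k F F' :
  (forall phi g, F phi g = F' phi g) -> expressible k F -> expressible k F'.
Proof.
  intros E. apply realizable_sub. intros phi g g'. now rewrite E.
Qed.

(** Counting a register down destroys it, so each round increments both [k] and [k + 1], and the
    second copy is then moved back to [j]. *)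
Lemma expressible_var k j : j < k -> expressible k (fun _ g => g j).
Proof.
  intros Hj.
  eapply realizable_sub; [| exact (realizable_seq _ _
    (realizable_loop j (k + 2) _ (realizable_seq _ _ (realizable_inc k) (realizable_inc (k + 1))))
    (realizable_move (k + 1) j (k + 2) ltac:(lia) ltac:(lia) ltac:(lia)))].
  intros phi g g' [Hz ->].
  exists (upd (upd (upd g k (g k + g j)) (k + 1) (g (k + 1) + g j)) j 0).
  split.
  - assert (Ez : g (k + 2) = 0) by (apply Hz; lia). clear Hz.
    remember (g j) as n eqn:En. symmetry in En. revert g Ez En.
    induction n as [|n IH]; intros g Ez En.
    + match goal with |- loop_rel _ _ _ _ _ ?h => replace h with g by updf end.
      now constructor.
    + eapply loop_next; [exact En | eexists; split; reflexivity | updv; exact Ez |].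
      match goal with |- loop_rel _ _ _ _ ?h _ => set (g1 := h) end.
      match goal with |- loop_rel _ _ _ _ _ ?h =>
        replace h with (upd (upd (upd g1 k (g1 k + n)) (k + 1) (g1 (k + 1) + n)) j 0)
        by (unfold g1; updf) end.
      apply IH; unfold g1; updv; auto.
  - assert (E0 := Hz k ltac:(lia)). assert (E1 := Hz (k + 1) ltac:(lia)).
    assert (E2 := Hz (k + 2) ltac:(lia)).
    updv. split; [exact E2|]. updf.
Qed.

Lemma expressible_zero k : expressible k (fun _ _ => 0).
Proof.
  eapply realizable_sub; [| exact realizable_skip].
  intros phi g g' [Hz ->]. assert (E := Hz k (le_n k)). updf.
Qed.

Lemma expressible_S k F : expressible k F -> expressible k (fun phi g => S (F phi g)).
Proof.
  intros H. eapply realizable_sub; [| exact (realizable_seq _ _ H (realizable_inc k))].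
  intros phi g g' [Hz ->]. eexists; split; [split; [exact Hz | reflexivity] |].
  updv. updf.
Qed.

Lemma expressible_query k F :
  expressible k F -> expressible k (fun phi g => phi (F phi g)).
Proof.
  intros H. eapply realizable_sub; [| exact (realizable_seq _ _ H (realizable_query k))].
  intros phi g g' [Hz ->]. eexists; split; [split; [exact Hz | reflexivity] |].
  updv. updf.
Qed.

Lemma zero_from_upd k g v : zero_from k g -> zero_from (S k) (upd g k v).
Proof. intros H r Hr. updv. apply H. lia. Qed.

Lemma expressible_let k F G :
  expressible k F -> expressible (S k) G ->
  expressible k (fun phi g => G phi (upd g k (F phi g))).
Proof.
  intros HF HG. eapply realizable_sub; [| exact (realizable_seq _ _ HF
    (realizable_seq _ _ HG (realizable_seq _ _
      (realizable_clear k (k + 2) ltac:(lia))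
      (realizable_move (k + 1) k (k + 2) ltac:(lia) ltac:(lia) ltac:(lia)))))].
  intros phi g g' [Hz ->].
  eexists; split; [split; [exact Hz | reflexivity] |].
  eexists; split; [split; [now apply zero_from_upd | reflexivity] |].
  assert (E1 := Hz (k + 1) ltac:(lia)). assert (E2 := Hz (k + 2) ltac:(lia)).
  eexists; split; [split; [updv; exact E2 | reflexivity] |].
  updv. split; [exact E2|].
  replace (k + 1) with (S k) in * by lia. updv. updf.
Qed.

(** * Cantor pairing on registers *)

Definition triangle (n : nat) : nat := nat_rect (fun _ => nat) 0 (fun i r => S i + r) n.

(** The position of the pair on the diagonal walk of [unpair]: [triangle (x + y)] pairs lie on
    earlier diagonals, and each diagonal is walked with [y] increasing from 0. *)
Definition npair (x y : nat) : nat := triangle (x + y) + y.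

Lemma unpair_S n : unpair (S n) =
  match fst (unpair n) with
  | 0 => (S (snd (unpair n)), 0)
  | S x => (x, S (snd (unpair n)))
  end.
Proof. simpl. now destruct (unpair n) as [[|x] y]. Qed.

Lemma npair_S_0 s : npair (S s) 0 = S (npair 0 s).
Proof. unfold npair. rewrite !Nat.add_0_r, Nat.add_0_l. simpl. lia. Qed.

Lemma npair_S_r x y : npair x (S y) = S (npair (S x) y).
Proof. unfold npair. replace (x + S y) with (S x + y); lia. Qed.

Lemma unpair_npair x y : unpair (npair x y) = (x, y).
Proof.
  remember (x + y) as s eqn:Es. revert x y Es.
  induction s as [|s IHs]; intros x y Es.
  - assert (x = 0) by lia. assert (y = 0) by lia. now subst.
  - revert x Es. induction y as [|y IHy]; intros x Es.
    + replace x with (S s) by lia. now rewrite npair_S_0, unpair_S, IHs.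
    + now rewrite npair_S_r, unpair_S, IHy by lia.
Qed.

Lemma npair_unpair n : npair (fst (unpair n)) (snd (unpair n)) = n.
Proof.
  induction n as [|n IH]; [reflexivity|]. rewrite unpair_S.
  destruct (fst (unpair n)) as [|x]; simpl fst; simpl snd.
  - now rewrite npair_S_0, IH.
  - now rewrite npair_S_r, IH.
Qed.

Definition nfst (n : nat) : nat := fst (unpair n).
Definition nsnd (n : nat) : nat := snd (unpair n).

Lemma nfst_npair x y : nfst (npair x y) = x.
Proof. unfold nfst. now rewrite unpair_npair. Qed.

Lemma nsnd_npair x y : nsnd (npair x y) = y.
Proof. unfold nsnd. now rewrite unpair_npair. Qed.

(* One round of the loop is one step of the recursion defining [unpair]. *)
Lemma realizable_unpair n x y z :
  n <> x -> n <> y -> n <> z -> x <> y -> x <> z -> y <> z ->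
  realizable (fun _ g g' => g z = 0 /\ g x = 0 /\ g y = 0 /\
    g' = upd (upd (upd g x (nfst (g n))) y (nsnd (g n))) n 0).
Proof.
  intros. eapply realizable_sub; [| exact (realizable_loop n z _
    (realizable_if x z _ _ (realizable_inc y)
      (realizable_seq _ _ (realizable_move y x z ltac:(lia) ltac:(lia) ltac:(lia))
                          (realizable_inc x))))].
  intros phi g g' (Ez & Ex & Ey & ->).
  remember (g n) as c eqn:Ec. symmetry in Ec.
  assert (Gen : forall c a g, g n = c -> g z = 0 -> g x = nfst a -> g y = nsnd a ->
    loop_rel n z (fun phi g g' =>
      (g x = 0 /\ (exists g1, (g z = 0 /\ g1 = upd (upd g x (g x + g y)) y 0) /\
                 g' = upd g1 x (S (g1 x)))) \/
      (exists v, g x = S v /\ g' = upd (upd g x v) y (S (upd g x v y)) /\ g' z = 0)) phi g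
      (upd (upd (upd g x (nfst (c + a))) y (nsnd (c + a))) n 0)).
  { clear -H H0 H1 H2 H3 H4. induction c as [|c IH]; intros a g Ec Ez Ex Ey.
    - simpl. rewrite <- Ex, <- Ey.
      replace (upd (upd (upd g x (g x)) y (g y)) n 0) with g by updf. now constructor.
    - destruct (nfst a) as [|v] eqn:Ea.
      + eapply loop_next; [exact Ec | left; split; [updv; exact Ex |
          eexists; split; [split; [updv; exact Ez | reflexivity] | reflexivity]] |
          updv; exact Ez |].
        match goal with |- loop_rel _ _ _ _ ?h _ => set (g1 := h) end.
        assert (Ea' : unpair (S a) = (S (nsnd a), 0)).
        { simpl. unfold nfst, nsnd in *. destruct (unpair a). simpl in *. now subst. }
        replace (upd (upd (upd g x (nfst (S c + a))) y (nsnd (S c + a))) n 0)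
          with (upd (upd (upd g1 x (nfst (c + S a))) y (nsnd (c + S a))) n 0)
          by (unfold g1; replace (S c + a) with (c + S a) by lia; updf).
        apply IH; unfold g1, nfst, nsnd; updv; rewrite ?Ea'; simpl; auto.
        rewrite Ex, Ey. reflexivity.
      + eapply loop_next; [exact Ec | right; exists v; split; [updv; exact Ex |
          split; [reflexivity | updv; exact Ez]] | updv; exact Ez |].
        match goal with |- loop_rel _ _ _ _ ?h _ => set (g1 := h) end.
        assert (Ea' : unpair (S a) = (v, S (nsnd a))).
        { simpl. unfold nfst, nsnd in *. destruct (unpair a). simpl in *. now subst. }
        replace (upd (upd (upd g x (nfst (S c + a))) y (nsnd (S c + a))) n 0)
          with (upd (upd (upd g1 x (nfst (c + S a))) y (nsnd (c + S a))) n 0)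
          by (unfold g1; replace (S c + a) with (c + S a) by lia; updf).
        apply IH; unfold g1, nfst, nsnd; updv; rewrite ?Ea'; simpl; auto. }
  specialize (Gen c 0 g Ec Ez Ex Ey). now rewrite Nat.add_0_r in Gen.
Qed.

Lemma expressible_nfst k j : j < k -> expressible k (fun _ g => nfst (g j)).
Proof.
  intros Hj. eapply realizable_sub; [| exact (realizable_seq _ _ (expressible_var k j Hj)
    (realizable_seq _ _ (realizable_unpair k (k + 1) (k + 2) (k + 3)
       ltac:(lia) ltac:(lia) ltac:(lia) ltac:(lia) ltac:(lia) ltac:(lia))
    (realizable_seq _ _ (realizable_clear (k + 2) (k + 3) ltac:(lia))
      (realizable_move (k + 1) k (k + 3) ltac:(lia) ltac:(lia) ltac:(lia)))))].
  intros phi g g' [Hz ->].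
  assert (E1 := Hz (k + 1) ltac:(lia)). assert (E2 := Hz (k + 2) ltac:(lia)).
  assert (E3 := Hz (k + 3) ltac:(lia)).
  eexists; split; [split; [exact Hz | reflexivity] |].
  eexists; split; [updv; repeat split; eauto |].
  eexists; split; [split; [updv; exact E3 | reflexivity] |].
  updv. split; [exact E3|]. updf.
Qed.

Lemma expressible_nsnd k j : j < k -> expressible k (fun _ g => nsnd (g j)).
Proof.
  intros Hj. eapply realizable_sub; [| exact (realizable_seq _ _ (expressible_var k j Hj)
    (realizable_seq _ _ (realizable_unpair k (k + 1) (k + 2) (k + 3)
       ltac:(lia) ltac:(lia) ltac:(lia) ltac:(lia) ltac:(lia) ltac:(lia))
    (realizable_seq _ _ (realizable_clear (k + 1) (k + 3) ltac:(lia))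
      (realizable_move (k + 2) k (k + 3) ltac:(lia) ltac:(lia) ltac:(lia)))))].
  intros phi g g' [Hz ->].
  assert (E1 := Hz (k + 1) ltac:(lia)). assert (E2 := Hz (k + 2) ltac:(lia)).
  assert (E3 := Hz (k + 3) ltac:(lia)).
  eexists; split; [split; [exact Hz | reflexivity] |].
  eexists; split; [updv; repeat split; eauto |].
  eexists; split; [split; [updv; exact E3 | reflexivity] |].
  updv. split; [exact E3|]. updf.
Qed.

(** Register [k] counts the rounds left, [k + 1] the rounds done, [k + 2] accumulates, [k + 3]
    receives the value of the body and [k + 4] stays 0 for jumps. The last two hypotheses make [B]
    independent of the counter and [F] of all working registers, whose contents change from round to
    round. *)
Lemma expressible_rec k N B (F : (nat -> nat) -> (nat -> nat) -> nat -> nat -> nat) :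
  expressible k N -> expressible (k + 2) B ->
  expressible (k + 3) (fun phi g => F phi g (g (k + 1)) (g (k + 2))) ->
  (forall phi g v, B phi (upd g k v) = B phi g) ->
  (forall phi g r v i w, k <= r -> F phi (upd g r v) i w = F phi g i w) ->
  expressible k (fun phi g => nat_rect (fun _ => nat) (B phi g) (F phi g) (N phi g)).
Proof.
  intros HN HB HF EB EF.
  eapply realizable_sub; [| exact (realizable_seq _ _ HN (realizable_seq _ _ HB
    (realizable_seq _ _ (realizable_loop k (k + 4) _
      (realizable_seq _ _ HF (realizable_seq _ _
        (realizable_clear (k + 2) (k + 4) ltac:(lia)) (realizable_seq _ _
        (realizable_move (k + 3) (k + 2) (k + 4) ltac:(lia) ltac:(lia) ltac:(lia))
        (realizable_inc (k + 1))))))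
    (realizable_seq _ _ (realizable_clear (k + 1) (k + 4) ltac:(lia))
      (realizable_move (k + 2) k (k + 4) ltac:(lia) ltac:(lia) ltac:(lia))))))].
  intros phi g g' [Hz ->].
  assert (E1 := Hz (k + 1) ltac:(lia)). assert (E2 := Hz (k + 2) ltac:(lia)).
  assert (E3 := Hz (k + 3) ltac:(lia)). assert (E4 := Hz (k + 4) ltac:(lia)).
  eexists; split; [split; [exact Hz | reflexivity] |].
  eexists; split; [split; [intros r Hr; updv; apply Hz; lia | reflexivity] |].
  rewrite EB. set (n := N phi g).
  set (acc := nat_rect (fun _ => nat) (B phi g) (F phi g)).
  exists (upd (upd (upd g k 0) (k + 1) n) (k + 2) (acc n)). split.
  (* Invariant: with [m] rounds left and [i] done, the accumulator holds the [i]-th value of the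
     recursion. *)
  - assert (Gen : forall m i, m + i = n ->
      loop_rel k (k + 4) (fun phi g g' => exists g1,
        (zero_from (k + 3) g /\ g1 = upd g (k + 3) (F phi g (g (k + 1)) (g (k + 2)))) /\
        exists g2, (g1 (k + 4) = 0 /\ g2 = upd g1 (k + 2) 0) /\
        exists g3, (g2 (k + 4) = 0 /\
           g3 = upd (upd g2 (k + 2) (g2 (k + 2) + g2 (k + 3))) (k + 3) 0) /\
        g' = upd g3 (k + 1) (S (g3 (k + 1)))) phi
        (upd (upd (upd g k m) (k + 1) i) (k + 2) (acc i))
        (upd (upd (upd g k 0) (k + 1) n) (k + 2) (acc n))).
    { induction m as [|m IH]; intros i Hi.
      - simpl in Hi. subst i. constructor. now updv.
      - eapply loop_next; [updv; reflexivity | | | apply (IH (S i)); lia].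
        + eexists; split; [split; [intros r Hr; updv; apply Hz; lia | reflexivity] |].
          eexists; split; [split; [updv; exact E4 | reflexivity] |].
          eexists; split; [split; [updv; exact E4 | reflexivity] |].
          updv. rewrite !EF by lia. change (F phi g i (acc i)) with (acc (S i)). updf.
        + updv. exact E4. }
    specialize (Gen n 0 (Nat.add_0_r n)).
    match goal with |- loop_rel _ _ _ _ ?h _ =>
      replace h with (upd (upd (upd g k n) (k + 1) 0) (k + 2) (acc 0)); [exact Gen|] end.
    unfold acc; simpl. updf.
  - eexists; split; [split; [updv; exact E4 | reflexivity] |].
    updv. split; [exact E4|]. updf.
Qed.

Lemma expressible_add k i j : i < k -> j < k -> expressible k (fun _ g => g i + g j).
Proof.
  intros Hi Hj. apply expressible_ext with
    (F := fun phi g => nat_rect (fun _ => nat) (g i) (fun _ r => S r) (g j)).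
  - intros phi g. induction (g j) as [|n IH]; simpl; lia.
  - apply (expressible_rec k (fun _ g => g j) (fun _ g => g i) (fun _ _ _ r => S r)).
    + now apply expressible_var.
    + apply expressible_var; lia.
    + apply expressible_S, expressible_var; lia.
    + intros. now updv.
    + reflexivity.
Qed.

Lemma expressible_triangle k j : j < k -> expressible k (fun _ g => triangle (g j)).
Proof.
  intros Hj.
  apply (expressible_rec k (fun _ g => g j) (fun _ _ => 0) (fun _ _ i r => S i + r)).
  - now apply expressible_var.
  - apply expressible_zero.
  - apply (expressible_S (k + 3) (fun _ g => g (k + 1) + g (k + 2))), expressible_add; lia.
  - reflexivity.
  - reflexivity.
Qed.

Lemma expressible_npair k i j :
  i < k -> j < k -> expressible k (fun _ g => npair (g i) (g j)).
Proof.
  intros Hi Hj.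
  eapply expressible_ext; [| exact (expressible_let k _ _ (expressible_add k i j Hi Hj)
    (expressible_let (S k) _ _ (expressible_triangle (S k) k ltac:(lia))
      (expressible_add (S (S k)) (S k) j ltac:(lia) ltac:(lia))))].
  intros phi g; simpl. now updv.
Qed.

(** * Recursive functions of one variable, with tuples coded by [npair] *)

Definition recursive (F : (nat -> nat) -> nat -> nat) : Prop :=
  forall k j, j < k -> expressible k (fun phi g => F phi (g j)).

Lemma recursive_id : recursive (fun _ x => x).
Proof. intros k j Hj. now apply expressible_var. Qed.

(** The inner value becomes a new variable in register [k], and the outer function is evaluated with
    scratch space from [S k] on. For this reason [recursive] asks for evaluation at every [k]. *)
Lemma recursive_comp F G :
  recursive F -> recursive G -> recursive (fun phi x => F phi (G phi x)).
Proof.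
  intros HF HG k j Hj.
  eapply expressible_ext; [| exact (expressible_let k _ _ (HG k j Hj) (HF (S k) k ltac:(lia)))].
  intros phi g; simpl. now updv.
Qed.

Lemma recursive_const c : recursive (fun _ _ => c).
Proof.
  intros k j Hj. induction c as [|c IH].
  - apply expressible_zero.
  - now apply expressible_S in IH.
Qed.

Lemma recursive_S F : recursive F -> recursive (fun phi x => S (F phi x)).
Proof. intros H k j Hj. now apply expressible_S, H. Qed.

Lemma recursive_query F : recursive F -> recursive (fun phi x => phi (F phi x)).
Proof. intros H k j Hj. now apply (expressible_query k (fun phi g => F phi (g j))), H. Qed.

Lemma recursive_nfst F : recursive F -> recursive (fun phi x => nfst (F phi x)).
Proof.
  apply (recursive_comp (fun _ => nfst)). intros k j. apply expressible_nfst.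
Qed.

Lemma recursive_nsnd F : recursive F -> recursive (fun phi x => nsnd (F phi x)).
Proof.
  apply (recursive_comp (fun _ => nsnd)). intros k j. apply expressible_nsnd.
Qed.

Lemma recursive_npair F G :
  recursive F -> recursive G -> recursive (fun phi x => npair (F phi x) (G phi x)).
Proof.
  intros HF HG k j Hj.
  eapply expressible_ext; [| exact (expressible_let k _ _ (HF k j Hj)
    (expressible_let (S k) _ _ (HG (S k) j ltac:(lia))
      (expressible_npair (S (S k)) k (S k) ltac:(lia) ltac:(lia))))].
  intros phi g; simpl. now updv.
Qed.

Definition natrec (n b : nat) (s : nat -> nat -> nat) : nat :=
  nat_rect (fun _ => nat) b s n.

(** The step depends on parameter, index and accumulator; packing these three into nested pairs
    reduces it to a function of one variable. *)
Lemma recursive_natrec N B (s : (nat -> nat) -> nat -> nat -> nat -> nat) :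
  recursive N -> recursive B ->
  recursive (fun phi y => s phi (nfst y) (nfst (nsnd y)) (nsnd (nsnd y))) ->
  recursive (fun phi x => natrec (N phi x) (B phi x) (fun i r => s phi x i r)).
Proof.
  intros HN HB Hs k j Hj.
  apply (expressible_rec k (fun phi g => N phi (g j)) (fun phi g => B phi (g j))
    (fun phi g i r => s phi (g j) i r)).
  - now apply HN.
  - apply HB; lia.
  - replace (k + 3) with (S (k + 2)) by lia.
    eapply expressible_ext; [| exact (expressible_let _ _ _
      (expressible_npair (S (k + 2)) (k + 1) (k + 2) ltac:(lia) ltac:(lia))
      (expressible_let _ _ _
        (expressible_npair (S (S (k + 2))) j (S (k + 2)) ltac:(lia) ltac:(lia))
        (Hs (S (S (S (k + 2)))) (S (S (k + 2))) ltac:(lia))))].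
    intros phi g; cbv beta. updv. rewrite !nsnd_npair, !nfst_npair. reflexivity.
  - intros. now updv.
  - intros. now updv.
Qed.

(** An endless loop: evaluate [F] at register 0 into register 1, print it, clear register 1,
    increment register 0, and jump back through register 2, which is always 0. Every round starts
    with all registers but the first empty, which is the invariant [Round]. *)
Lemma computes_of_recursive F : recursive F ->
  exists M, forall phi, computes M phi (F phi).
Proof.
  intros HF.
  assert (HR := realizable_seq _ _ (realizable_clear 1 2 ltac:(lia)) (realizable_inc 0)).
  destruct (HF 1 0 ltac:(lia) 0) as [c1 H1].
  destruct (HR (S (length c1))) as [c2 H2].
  exists (c1 ++ Out 1 :: c2 ++ [JZDec 2 0]). intros phi.
  set (P := c1 ++ Out 1 :: c2 ++ [JZDec 2 0]).
  assert (HP : code_at P 0 P) by (intros i ins E; exact E).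
  apply code_at_app in HP as [A1 HP]. apply code_at_cons in HP as [A2 HP].
  apply code_at_app in HP as [A3 HP]. apply code_at_cons in HP as [A4 _].
  specialize (H1 phi P A1). specialize (H2 phi P A3). simpl in A2, A3, A4.
  assert (Round : forall n, exists m,
    run phi P m = (mkConfig 0 (upd (fun _ => 0) 0 n), map (F phi) (seq 0 n))).
  { induction n as [|n [m Em]].
    - exists 0. simpl. f_equal. f_equal. updf.
    - rewrite seq_S, map_app. eapply run_steps; [| exact Em].
      change (map (F phi) [0 + n]) with ([] ++ [F phi n] : list nat).
      eapply steps_trans; [apply H1; split; [intros r Hr; now updv | reflexivity] |].
      eapply steps_out; [unfold step; simpl; rewrite A2; updv; reflexivity |].
      change (@nil nat) with (@nil nat ++ @nil nat). eapply steps_trans.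
      + apply H2. eexists. split; [split; [now updv | reflexivity] | reflexivity].
      + eapply steps_silent; [eapply step_jz_zero; [exact A4 | now updv] |].
        match goal with |- steps _ _ (mkConfig _ ?h) _ (mkConfig _ ?h') =>
          replace h' with h; [constructor |] end.
        updv. updf. }
  intros n. destruct (Round (S n)) as [m Em]. exists m. rewrite Em.
  apply map_nth_error. rewrite nth_error_seq.
  destruct (Nat.ltb_spec n (S n)); [reflexivity | lia].
Qed.

Lemma nsnd_le n : nsnd n <= n.
Proof. rewrite <- (npair_unpair n) at 2. unfold npair, nsnd. lia. Qed.

Local Opaque npair nfst nsnd.

Lemma recursive_ext F G :
  (forall phi x, F phi x = G phi x) -> recursive F -> recursive G.
Proof.
  intros E H k j Hj. apply expressible_ext with (F := fun phi g => F phi (g j)); auto.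
Qed.

(* Extended with [::=] whenever new closure lemmas are available. *)
Ltac rec_known := fail.

Ltac recsolve :=
  repeat (cbv beta; first
    [ assumption
    | apply recursive_id
    | match goal with H : recursive ?F |- _ => apply (recursive_comp F); [exact H |] end
    | solve [apply recursive_const]
    | apply recursive_npair
    | apply recursive_nfst
    | apply recursive_nsnd
    | rec_known
    | apply recursive_natrec
    | apply recursive_query
    | apply recursive_S ]).

Lemma recursive_add F G :
  recursive F -> recursive G -> recursive (fun phi x => F phi x + G phi x).
Proof.
  intros HF HG. apply recursive_ext
    with (fun phi x => natrec (G phi x) (F phi x) (fun _ r => S r)).
  - intros phi x. induction (G phi x) as [|n IH]; simpl in *; lia.
  - recsolve.
Qed.

Lemma recursive_mul F G :
  recursive F -> recursive G -> recursive (fun phi x => F phi x * G phi x).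
Proof.
  intros HF HG. apply recursive_ext
    with (fun phi x => natrec (G phi x) 0 (fun _ r => r + F phi x)).
  - intros phi x. induction (G phi x) as [|n IH]; simpl in *; lia.
  - recsolve. apply recursive_add; recsolve.
Qed.

Lemma recursive_sub F G :
  recursive F -> recursive G -> recursive (fun phi x => F phi x - G phi x).
Proof.
  intros HF HG. apply recursive_ext
    with (fun phi x => natrec (G phi x) (F phi x) (fun _ r => natrec r 0 (fun i _ => i))).
  - intros phi x. induction (G phi x) as [|n IH]; simpl in *; [lia |].
    rewrite IH. destruct (F phi x - n) eqn:E; simpl; lia.
  - recsolve.
Qed.

Ltac rec_known ::= first [apply recursive_add | apply recursive_mul | apply recursive_sub].

(* Decidable conditions are coded by "defects": the number 0 stands for truth, so that
   sums are conjunctions and products are disjunctions. *)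
Definition ifz (d a b : nat) : nat := natrec d a (fun _ _ => b).

Definition neqd (a b : nat) : nat := (a - b) + (b - a).

Lemma neqd_spec a b : neqd a b = 0 <-> a = b.
Proof. unfold neqd. lia. Qed.

Lemma recursive_ifz D F G : recursive D -> recursive F -> recursive G ->
  recursive (fun phi x => ifz (D phi x) (F phi x) (G phi x)).
Proof. intros. unfold ifz. recsolve. Qed.

Lemma recursive_neqd F G : recursive F -> recursive G ->
  recursive (fun phi x => neqd (F phi x) (G phi x)).
Proof. intros. unfold neqd. recsolve. Qed.

Definition parity (n : nat) : nat := natrec n 0 (fun _ r => 1 - r).

Definition half (n : nat) : nat := natrec n 0 (fun i r => r + parity i).

Lemma parity_spec n : parity n = if Nat.even n then 0 else 1.
Proof.
  induction n as [|n IH]; [reflexivity|].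
  rewrite Nat.even_succ, <- Nat.negb_even. unfold parity in *. simpl in *. rewrite IH.
  now destruct (Nat.even n).
Qed.

Lemma half_spec n : half n = Nat.div2 n.
Proof.
  assert (H : 2 * half n + parity n = n).
  { induction n as [|n IH]; [reflexivity|].
    change (half (S n)) with (half n + parity n). change (parity (S n)) with (1 - parity n).
    rewrite parity_spec in *. destruct (Nat.even n); lia. }
  assert (E := Nat.div2_odd n). rewrite <- Nat.negb_even in E.
  rewrite parity_spec in H. destruct (Nat.even n); simpl in E; lia.
Qed.

Lemma recursive_parity F : recursive F -> recursive (fun phi x => parity (F phi x)).
Proof. intros. unfold parity. recsolve. Qed.

Lemma recursive_half F : recursive F -> recursive (fun phi x => half (F phi x)).
Proof. intros. unfold half, parity. recsolve. Qed.

Ltac rec_known ::= first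
  [ apply recursive_add | apply recursive_mul | apply recursive_sub
  | apply recursive_ifz | apply recursive_neqd | apply recursive_parity | apply recursive_half ].

(** * Simulating machines given by their codes *)

(** The coding used by [prog_of_nat_aux]: 0 is the empty list and successors are cells. A machine
    code is thus already a list of instruction codes. *)
Definition lcons (a l : nat) : nat := S (npair a l).
Definition lhd (l : nat) : nat := natrec l 0 (fun m _ => nfst m).
Definition ltl (l : nat) : nat := natrec l 0 (fun m _ => nsnd m).
Definition ldrop (i l : nat) : nat := natrec i l (fun _ r => ltl r).
Definition lnth (l i : nat) : nat := lhd (ldrop i l).

Lemma ltl_cons a l : ltl (lcons a l) = l.
Proof. apply nsnd_npair. Qed.

Lemma lhd_cons a l : lhd (lcons a l) = a.
Proof. apply nfst_npair. Qed.

Lemma ltl_lt l : l <> 0 -> ltl l < l.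
Proof. destruct l as [|m]; [easy|]. intros _. assert (H := nsnd_le m). unfold ltl. simpl. lia. Qed.

Lemma ldrop_S i l : ldrop (S i) l = ldrop i (ltl l).
Proof. induction i as [|i IH]; [reflexivity|]. unfold ldrop in *. simpl in *. now rewrite IH. Qed.

Lemma ldrop_0 i : ldrop i 0 = 0.
Proof. induction i as [|i IH]; [reflexivity|]. now rewrite ldrop_S. Qed.

(** A tail has a smaller code than its list, so no list is longer than its code. The code can
    therefore serve as a bound when all entries are inspected. *)
Lemma ldrop_ge i l : l <= i -> ldrop i l = 0.
Proof.
  revert l. induction i as [|i IH]; intros l H.
  - replace l with 0 by lia. reflexivity.
  - rewrite ldrop_S. destruct (Nat.eq_dec l 0) as [->|Hl]; [apply ldrop_0 |].
    apply IH. assert (E := ltl_lt l Hl). lia.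
Qed.

Lemma lnth_ge l i : l <= i -> lnth l i = 0.
Proof. intros H. unfold lnth. now rewrite ldrop_ge. Qed.

Definition lcode (l : list nat) : nat := fold_right lcons 0 l.

Lemma lnth_lcode l i : lnth (lcode l) i = nth i l 0.
Proof.
  unfold lnth. revert i. induction l as [|a l IH]; intros i; simpl.
  - rewrite ldrop_0. now destruct i.
  - destruct i as [|i]; [apply lhd_cons |]. now rewrite ldrop_S, ltl_cons, IH.
Qed.

(* Register contents are coded as association lists, the most recent entry first. *)
Definition afind_from (n c r : nat) : nat :=
  natrec n c (fun _ l => ifz (neqd (nfst (lhd l)) r) l (ltl l)).
Definition alookup (c r : nat) : nat := nsnd (lhd (afind_from c c r)).
Definition aupdate (c r v : nat) : nat := lcons (npair r v) c.

Lemma afind_from_S n c r :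
  afind_from (S n) c r = afind_from n (ifz (neqd (nfst (lhd c)) r) c (ltl c)) r.
Proof.
  induction n as [|n IH]; [reflexivity|]. unfold afind_from in *. simpl in *. now rewrite IH.
Qed.

(** Lookup uses the list code as fuel, so after an update the search in the old list runs with too
    much fuel; the surplus must not change the result. *)
Lemma afind_from_stable n c r : c <= n -> afind_from n c r = afind_from c c r.
Proof.
  revert n. induction c as [c IH] using (well_founded_induction lt_wf). intros n Hn.
  destruct (Nat.eq_dec c 0) as [->|Hc].
  - clear. induction n as [|n IH]; [reflexivity|]. rewrite afind_from_S.
    replace (ifz (neqd (nfst (lhd 0)) r) 0 (ltl 0)) with 0; auto.
    unfold ifz. now destruct (neqd _ _).
  - destruct c as [|c]; [easy|]. destruct n as [|n]; [lia|].
    rewrite !afind_from_S. unfold ifz. destruct (neqd (nfst (lhd (S c))) r) eqn:E; simpl.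
    + assert (Fix : forall m, afind_from m (S c) r = S c).
      { induction m as [|m IHm]; [reflexivity|]. rewrite afind_from_S, E. exact IHm. }
      now rewrite !Fix.
    + assert (L := ltl_lt (S c) Hc). transitivity (afind_from (ltl (S c)) (ltl (S c)) r);
        [| symmetry]; apply IH; lia.
Qed.

Lemma alookup_aupdate c r v i :
  alookup (aupdate c r v) i = if Nat.eqb i r then v else alookup c i.
Proof.
  unfold alookup, aupdate. set (c' := lcons (npair r v) c).
  assert (Hc : c' <> 0) by discriminate.
  destruct c' as [|n] eqn:Ec; [easy|]. rewrite afind_from_S, <- Ec.
  unfold c' in *. rewrite lhd_cons, ltl_cons, nfst_npair. unfold ifz.
  destruct (Nat.eqb_spec i r) as [->|Hi].
  - replace (neqd r r) with 0 by (symmetry; now apply neqd_spec). simpl.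
    assert (Fix : forall m, afind_from m (lcons (npair r v) c) r = lcons (npair r v) c).
    { induction m as [|m IHm]; [reflexivity|]. rewrite afind_from_S, lhd_cons, nfst_npair.
      replace (neqd r r) with 0 by (symmetry; now apply neqd_spec). exact IHm. }
    now rewrite Fix, lhd_cons, nsnd_npair.
  - destruct (neqd r i) eqn:E; [apply (proj1 (neqd_spec _ _)) in E; congruence |]. simpl natrec.
    rewrite afind_from_stable; auto.
    assert (L := ltl_lt _ Hc). assert (E' := ltl_cons (npair r v) c). rewrite Ec in E'. lia.
Qed.

(* Simulated machines read their oracle partly from the real one, and partly from a
   finite list [s] padded with zeros: [s] supplies the answers at odd arguments. *)
Definition sim_query (phi : nat -> nat) (s x : nat) : nat :=
  ifz (parity x) (phi (2 * x)) (lnth s x).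

(** Recursions that ignore their accumulator act as case distinctions: they split the operation code
    [k] into 0, 1, 2 and larger, in the order of [instr_of_nat]. The last one tests the register of
    [JZDec]. *)
Definition sim_instr (phi : nat -> nat) (s pc rg k m : nat) : nat :=
  natrec k (npair (S pc) (aupdate rg m (S (alookup rg m))))
    (fun k1 _ => natrec k1 (npair (S pc) (aupdate rg m (sim_query phi s (alookup rg m))))
      (fun k2 _ => natrec k2 (npair (S pc) rg)
        (fun _ _ => natrec (alookup rg (nfst m)) (npair (nsnd m) rg)
           (fun v _ => npair (S pc) (aupdate rg (nfst m) v))))).

Definition sim_step (phi : nat -> nat) (s e c : nat) : nat :=
  natrec (ldrop (nfst c) e) c
    (fun m _ => sim_instr phi s (nfst c) (nsnd c) (nfst (nfst m)) (nsnd (nfst m))).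

(** The start value 0 codes program counter 0 together with the empty association list, in which
    every register reads 0. *)
Definition sim_state (phi : nat -> nat) (s e t : nat) : nat :=
  natrec t 0 (fun _ c => sim_step phi s e c).

(** The value 0 stands both for no output and for the output 0. The two need not be told apart,
    because 0 is padding in names. *)
Definition sim_emit (e c : nat) : nat :=
  natrec (ldrop (nfst c) e) 0
    (fun m _ => ifz (neqd (nfst (nfst m)) 2) (alookup (nsnd c) (nsnd (nfst m))) 0).

Definition sim_out (phi : nat -> nat) (s e t : nat) : nat :=
  sim_emit e (sim_state phi s e t).

Lemma recursive_lnth F G : recursive F -> recursive G ->
  recursive (fun phi x => lnth (F phi x) (G phi x)).
Proof. intros. unfold lnth, lhd, ldrop, ltl. recsolve. Qed.

Lemma recursive_ldrop F G : recursive F -> recursive G ->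
  recursive (fun phi x => ldrop (F phi x) (G phi x)).
Proof. intros. unfold ldrop, ltl. recsolve. Qed.

Lemma recursive_alookup F G : recursive F -> recursive G ->
  recursive (fun phi x => alookup (F phi x) (G phi x)).
Proof. intros. unfold alookup, afind_from, lhd, ltl. recsolve. Qed.

Lemma recursive_aupdate F G H : recursive F -> recursive G -> recursive H ->
  recursive (fun phi x => aupdate (F phi x) (G phi x) (H phi x)).
Proof. intros. unfold aupdate, lcons. recsolve. Qed.

Ltac rec_known ::= first
  [ apply recursive_add | apply recursive_mul | apply recursive_sub
  | apply recursive_ifz | apply recursive_neqd | apply recursive_parity | apply recursive_half
  | apply recursive_lnth | apply recursive_ldrop | apply recursive_alookup
  | apply recursive_aupdate ].

Lemma recursive_sim_step F G H : recursive F -> recursive G -> recursive H ->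
  recursive (fun phi x => sim_step phi (F phi x) (G phi x) (H phi x)).
Proof.
  intros. unfold sim_step, sim_instr, sim_query. recsolve.
Qed.

Lemma recursive_sim_out F G H : recursive F -> recursive G -> recursive H ->
  recursive (fun phi x => sim_out phi (F phi x) (G phi x) (H phi x)).
Proof.
  intros. unfold sim_out, sim_emit, sim_state. recsolve; apply recursive_sim_step; recsolve.
Qed.

Lemma nth_error_prog_of_nat_aux fuel n i : n <= fuel ->
  nth_error (prog_of_nat_aux fuel n) i =
  match ldrop i n with 0 => None | S m => Some (instr_of_nat (nfst m)) end.
Proof.
  revert n i. induction fuel as [|fuel IH]; intros n i Hn.
  - replace n with 0 by lia. rewrite ldrop_0. now destruct i.
  - destruct n as [|m]; simpl; [rewrite ldrop_0; now destruct i |].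
    rewrite (surjective_pairing (unpair m)).
    change (snd (unpair m)) with (nsnd m). change (fst (unpair m)) with (nfst m).
    destruct i as [|i]; [reflexivity |].
    rewrite ldrop_S. change (ltl (S m)) with (nsnd m). simpl.
    apply IH. assert (H := nsnd_le m). lia.
Qed.

Lemma instr_of_nat_eq a : instr_of_nat a =
  match nfst a with
  | 0 => Inc (nsnd a)
  | 1 => Query (nsnd a)
  | 2 => Out (nsnd a)
  | _ => JZDec (nfst (nsnd a)) (nsnd (nsnd a))
  end.
Proof.
  unfold instr_of_nat. rewrite (surjective_pairing (unpair a)).
  change (fst (unpair a)) with (nfst a). change (snd (unpair a)) with (nsnd a).
  now rewrite (surjective_pairing (unpair (nsnd a))).
Qed.

Definition represents (c : nat) (cf : config) : Prop :=
  nfst c = pc cf /\ forall r, alookup (nsnd c) r = regs cf r.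

Definition next_config (phi : nat -> nat) (P : prog) (c : config) : config :=
  match step phi P c with Some (c', _) => c' | None => c end.

Lemma fst_run_S phi P n : fst (run phi P (S n)) = next_config phi P (fst (run phi P n)).
Proof.
  simpl. destruct (run phi P n) as [c o]. unfold next_config. simpl.
  now destruct (step phi P c) as [[c' [v|]]|].
Qed.

Lemma sim_step_represents phi s e c cf :
  represents c cf ->
  represents (sim_step phi s e c) (next_config (sim_query phi s) (prog_of_nat e) cf).
Proof.
  intros [Hpc Hrg]. unfold next_config, step, prog_of_nat.
  rewrite nth_error_prog_of_nat_aux, <- Hpc by lia. unfold sim_step.
  destruct (ldrop (nfst c) e) as [|m]; [now split |]. simpl natrec. unfold sim_instr.
  rewrite instr_of_nat_eq.
  destruct (nfst (nfst m)) as [|[|[|k]]]; simpl natrec.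
  - split; [now rewrite nfst_npair |]. intros r. rewrite nsnd_npair, alookup_aupdate, !Hrg.
    reflexivity.
  - split; [now rewrite nfst_npair |]. intros r. rewrite nsnd_npair, alookup_aupdate, !Hrg.
    reflexivity.
  - split; [now rewrite nfst_npair |]. intros r. rewrite nsnd_npair. apply Hrg.
  - rewrite Hrg. destruct (regs cf (nfst (nsnd (nfst m)))) as [|v] eqn:E; simpl natrec.
    + split; [now rewrite nfst_npair |]. intros r. rewrite nsnd_npair. apply Hrg.
    + split; [now rewrite nfst_npair |]. intros r.
      rewrite nsnd_npair, alookup_aupdate, !Hrg. reflexivity.
Qed.

Lemma sim_state_represents phi s e t :
  represents (sim_state phi s e t) (fst (run (sim_query phi s) (prog_of_nat e) t)).
Proof.
  induction t as [|t IH].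
  - split; reflexivity.
  - rewrite fst_run_S. now apply sim_step_represents.
Qed.

(** * Finite use of the oracle *)

Definition emits (phi : nat -> nat) (P : prog) (t v : nat) : Prop :=
  exists c', step phi P (fst (run phi P t)) = Some (c', Some v).

Lemma sim_out_emits phi s e t v :
  sim_out phi s e t = S v <-> emits (sim_query phi s) (prog_of_nat e) t (S v).
Proof.
  destruct (sim_state_represents phi s e t) as [Hpc Hrg].
  unfold sim_out, sim_emit, emits, step, prog_of_nat.
  rewrite nth_error_prog_of_nat_aux by lia.
  change (prog_of_nat_aux e e) with (prog_of_nat e). rewrite <- Hpc.
  destruct (ldrop _ e) as [|m]; simpl natrec; [split; [easy | now intros [? ?]] |].
  rewrite instr_of_nat_eq, Hrg.
  destruct (nfst (nfst m)) as [|[|[|k]]]; simpl; try (split; [easy | now intros [? ?]]).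
  - split; [intros -> ; eauto | intros [c' E]; congruence].
  - split; [easy |]. intros [c' E]. now destruct (regs _ _).
Qed.

Lemma run_S_emits phi P t v : emits phi P t v ->
  nth_error (snd (run phi P (S t))) (length (snd (run phi P t))) = Some v.
Proof.
  intros [c' E]. simpl. destruct (run phi P t) as [c o]. simpl in *. rewrite E. simpl.
  rewrite nth_error_app2 by lia. now rewrite Nat.sub_diag.
Qed.

Lemma run_prefix phi P n m k v : n <= m ->
  nth_error (snd (run phi P n)) k = Some v -> nth_error (snd (run phi P m)) k = Some v.
Proof.
  induction 1 as [|m _ IH]; auto. intros E. apply IH in E. simpl.
  destruct (run phi P m) as [c o]. simpl in *.
  destruct (step phi P c) as [[c' [w|]]|]; simpl; auto.
  rewrite nth_error_app1; auto. apply nth_error_Some. congruence.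
Qed.

Lemma emits_of_run phi P n k v :
  nth_error (snd (run phi P n)) k = Some v -> exists t, t < n /\ emits phi P t v.
Proof.
  induction n as [|n IH]; intros E; [now destruct k |].
  destruct (nth_error (snd (run phi P n)) k) as [w|] eqn:Ek.
  - apply (run_prefix phi P n (S n)) in Ek; auto. rewrite Ek in E. injection E as ->.
    destruct IH as (t & Ht & H); eauto.
  - exists n. split; [lia |]. unfold emits. simpl in E.
    destruct (run phi P n) as [c o]. simpl in *.
    destruct (step phi P c) as [[c' [w|]]|]; simpl in *; try congruence.
    apply nth_error_None in Ek. rewrite nth_error_app2 in E by lia.
    destruct (k - length o) as [|j]; simpl in E; [| now destruct j].
    injection E as ->. eauto.
Qed.

(** The use principle: a finite computation asks finitely many questions. It allows passing between
    names and finite prefixes in both directions. *)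
Lemma run_use phi P n : exists N, forall psi,
  (forall x, x < N -> psi x = phi x) -> run psi P n = run phi P n.
Proof.
  induction n as [|n [N IH]]; [now exists 0 |].
  destruct (run phi P n) as [c o] eqn:E.
  (* The sum over all [Query] instructions bounds the argument of whichever one is executed next. *)
  exists (S (N + fold_right (fun i b => b + match i with Query r => regs c r | _ => 0 end) 0 P)).
  intros psi Hpsi. simpl. rewrite E, (IH psi) by (intros; apply Hpsi; lia).
  replace (step psi P c) with (step phi P c); [reflexivity |].
  unfold step. destruct (nth_error P (pc c)) as [[r|r j|r|r]|] eqn:Ei; auto.
  rewrite Hpsi; [reflexivity |].
  assert (regs c r <=
    fold_right (fun i b => b + match i with Query r => regs c r | _ => 0 end) 0 P); [| lia].
  apply nth_error_In in Ei. clear -Ei. induction P as [|i P IHP]; [easy |].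
  simpl. destruct Ei as [->|Hi]; [lia |]. specialize (IHP Hi). lia.
Qed.

(** For soundness: simulated output is also printed under any genuine oracle that agrees with the
    padded one on the cells used. *)
Lemma sim_out_run phi s e t v : sim_out phi s e t = S v ->
  exists N, forall psi, (forall x, x < N -> psi x = sim_query phi s x) ->
  exists n k, nth_error (snd (run psi (prog_of_nat e) n)) k = Some (S v).
Proof.
  intros E. apply sim_out_emits, run_S_emits in E.
  destruct (run_use (sim_query phi s) (prog_of_nat e) (S t)) as [N HN].
  exists N. intros psi Hpsi. exists (S t). eexists. rewrite (HN psi Hpsi). exact E.
Qed.

(** For completeness: genuine output is reproduced as soon as the list supplies the cells used. *)
Lemma run_sim_out psi e n k v : nth_error (snd (run psi (prog_of_nat e) n)) k = Some (S v) ->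
  exists N, forall phi s, (forall x, x < N -> sim_query phi s x = psi x) ->
  exists t, sim_out phi s e t = S v.
Proof.
  intros E. destruct (run_use psi (prog_of_nat e) n) as [N HN].
  exists N. intros phi s H. rewrite <- (HN _ H) in E.
  apply emits_of_run in E as (t & _ & E). exists t. now apply sim_out_emits.
Qed.

(** * Formal inclusion of basic open sets *)

(** Subtraction on [nat] is truncated, so the numerator coded by [z_of_nat] is kept as a difference
    of two naturals, one of which is 0. *)
Definition qpos (u : nat) : nat := (1 - parity (nfst u)) * half (nfst u).
Definition qneg (u : nat) : nat := parity (nfst u) * S (half (nfst u)).
Definition qden (u : nat) : nat := S (nsnd u).
Definition qval (u : nat) : R := Q2R (q_of_nat u).

Lemma qval_eq u : qval u = ((INR (qpos u) - INR (qneg u)) / INR (qden u))%R.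
Proof.
  unfold qval, q_of_nat, qpos, qneg, qden. rewrite (surjective_pairing (unpair u)).
  change (fst (unpair u)) with (nfst u). change (snd (unpair u)) with (nsnd u).
  unfold Q2R. simpl Qnum. simpl Qden. rewrite Zpos_P_of_succ_nat, <- Nat2Z.inj_succ.
  rewrite <- INR_IZR_INZ. unfold Rdiv. f_equal.
  unfold z_of_nat. rewrite parity_spec, half_spec, !INR_IZR_INZ, <- minus_IZR. f_equal.
  destruct (Nat.even (nfst u)); lia.
Qed.

Lemma qden_pos u : (0 < INR (qden u))%R.
Proof. apply lt_0_INR. unfold qden. lia. Qed.

Definition qled (u v : nat) : nat :=
  (qpos u * qden v + qneg v * qden u) - (qpos v * qden u + qneg u * qden v).

Lemma qled_spec u v : qled u v = 0 <-> (qval u <= qval v)%R.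
Proof.
  unfold qled. rewrite Nat.sub_0_le, !qval_eq.
  assert (Du := qden_pos u). assert (Dv := qden_pos v).
  transitivity (INR (qpos u * qden v + qneg v * qden u) <=
                INR (qpos v * qden u + qneg u * qden v))%R.
  { split; [apply le_INR | apply INR_le]. }
  rewrite !plus_INR, !mult_INR.
  set (A := INR (qpos u)) in *. set (A' := INR (qneg u)) in *. set (D := INR (qden u)) in *.
  set (B := INR (qpos v)) in *. set (B' := INR (qneg v)) in *. set (D' := INR (qden v)) in *.
  assert (E : ((B - B') / D' - (A - A') / D =
    ((B * D + A' * D') - (A * D' + B' * D)) * / (D * D'))%R) by (field; lra).
  assert (I : (0 < / (D * D'))%R) by (apply Rinv_0_lt_compat; nra).
  split; intros H; nra.
Qed.

Definition qplus (u : nat) : nat := qpos u - qneg u.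
Definition qminus (u : nat) : nat := qneg u - qpos u.

Lemma qplus_val u : (INR (qplus u) / INR (qden u) = Rmax (qval u) 0)%R.
Proof.
  assert (D := qden_pos u). rewrite qval_eq. unfold qplus.
  destruct (Nat.le_ge_cases (qneg u) (qpos u)) as [H|H].
  - rewrite minus_INR by exact H. apply le_INR in H.
    rewrite Rmax_left; [reflexivity |]. apply Rle_div_r; lra.
  - replace (qpos u - qneg u) with 0 by lia. apply le_INR in H.
    rewrite Rmax_right; [simpl; lra |]. apply Rle_div_l; lra.
Qed.

Lemma qminus_val u : (INR (qminus u) / INR (qden u) = Rmax (- qval u) 0)%R.
Proof.
  assert (D := qden_pos u). rewrite qval_eq. unfold qminus.
  replace (- ((INR (qpos u) - INR (qneg u)) / INR (qden u)))%R
    with ((INR (qneg u) - INR (qpos u)) / INR (qden u))%R by (field; lra).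
  destruct (Nat.le_ge_cases (qpos u) (qneg u)) as [H|H].
  - rewrite minus_INR by exact H. apply le_INR in H.
    rewrite Rmax_left; [reflexivity |]. apply Rle_div_r; lra.
  - replace (qneg u - qpos u) with 0 by lia. apply le_INR in H.
    rewrite Rmax_right; [simpl; lra |]. apply Rle_div_l; lra.
Qed.

(** Comparing squares avoids roots; both sides are multiplied by the square of [da * db * qden r] to
    clear denominators. *)
Definition fard (a da b db r : nat) : nat :=
  (qplus r * (da * db)) * (qplus r * (da * db)) -
  ((a * (db * qden r)) * (a * (db * qden r)) + (b * (da * qden r)) * (b * (da * qden r))).

Lemma fard_spec a da b db r : (0 < INR da)%R -> (0 < INR db)%R ->
  fard a da b db r = 0 <->
  (Rmax (qval r) 0 ^ 2 <= (INR a / INR da) ^ 2 + (INR b / INR db) ^ 2)%R.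
Proof.
  intros Da Db. unfold fard. rewrite Nat.sub_0_le, <- qplus_val.
  assert (Dr := qden_pos r).
  set (A := INR a) in *. set (B := INR b) in *. set (U := INR da) in *. set (V := INR db) in *.
  set (R := INR (qplus r)) in *. set (W := INR (qden r)) in *.
  assert (E1 : ((R / W) ^ 2 = ((R * (U * V)) * (R * (U * V))) / (U * V * W) ^ 2)%R) by (field; lra).
  assert (E2 : ((A / U) ^ 2 + (B / V) ^ 2 =
    ((A * (V * W)) * (A * (V * W)) + (B * (U * W)) * (B * (U * W))) / (U * V * W) ^ 2)%R)
    by (field; lra).
  rewrite E1, E2.
  assert (P : (0 < (U * V * W) ^ 2)%R) by (apply pow_lt; repeat apply Rmult_lt_0_compat; auto).
  split; intros H.
  - apply le_INR in H. rewrite plus_INR, !mult_INR in H. fold A B U V R W in H.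
    apply Rmult_le_compat_r; [left; now apply Rinv_0_lt_compat | exact H].
  - apply INR_le. rewrite plus_INR, !mult_INR. fold A B U V R W.
    apply Rmult_le_reg_r in H; [exact H | now apply Rinv_0_lt_compat].
Qed.

(* A point [x] of the interval [(a, b)] satisfies [|x| > max a 0] and [|x| > max (- b) 0],
   except where the bound is 0; the last four factors choose one bound for each coordinate. *)
Definition rect_extd (a b c d r : nat) : nat :=
  qplus r *
  (fard (qplus a) (qden a) (qplus c) (qden c) r *
  (fard (qplus a) (qden a) (qminus d) (qden d) r *
  (fard (qminus b) (qden b) (qplus c) (qden c) r *
   fard (qminus b) (qden b) (qminus d) (qden d) r))).

Definition rect_rectd (m k : nat) : nat :=
  qled (nfst (nfst k)) (nfst (nfst m)) + (qled (nsnd (nfst m)) (nsnd (nfst k)) +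
  (qled (nfst (nsnd k)) (nfst (nsnd m)) + qled (nsnd (nsnd m)) (nsnd (nsnd k)))).

(** Sufficient for inclusion but not necessary: an empty rectangle lies in every basic set and may
    still be rejected. The defect 1 reflects that an exterior contains infinity and a rectangle does
    not. *)
Definition subd (m k : nat) : nat :=
  ifz (nfst m)
    (ifz (nfst k) (rect_rectd (nsnd m) (nsnd k))
      (rect_extd (nfst (nfst (nsnd m))) (nsnd (nfst (nsnd m)))
                 (nfst (nsnd (nsnd m))) (nsnd (nsnd (nsnd m))) (nsnd k)))
    (ifz (nfst k) 1 (qled (nsnd k) (nsnd m))).

Lemma recursive_qled F G : recursive F -> recursive G ->
  recursive (fun phi x => qled (F phi x) (G phi x)).
Proof. intros. unfold qled, qpos, qneg, qden. recsolve. Qed.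

Lemma recursive_qplus F : recursive F -> recursive (fun phi x => qplus (F phi x)).
Proof. intros. unfold qplus, qpos, qneg. recsolve. Qed.

Lemma recursive_qminus F : recursive F -> recursive (fun phi x => qminus (F phi x)).
Proof. intros. unfold qminus, qpos, qneg. recsolve. Qed.

Lemma recursive_qden F : recursive F -> recursive (fun phi x => qden (F phi x)).
Proof. intros. unfold qden. recsolve. Qed.

Lemma recursive_fard A DA B DB F :
  recursive A -> recursive DA -> recursive B -> recursive DB -> recursive F ->
  recursive (fun phi x => fard (A phi x) (DA phi x) (B phi x) (DB phi x) (F phi x)).
Proof.
  intros. pose proof (recursive_qplus F H3). pose proof (recursive_qden F H3).
  unfold fard. repeat first [assumption | apply recursive_sub | apply recursive_add
    | apply recursive_mul].
Qed.

Ltac rec_known ::= first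
  [ apply recursive_qled | apply recursive_qplus | apply recursive_qminus
  | apply recursive_qden | apply recursive_fard
  | apply recursive_add | apply recursive_mul | apply recursive_sub
  | apply recursive_ifz ].

Lemma recursive_subd F G : recursive F -> recursive G ->
  recursive (fun phi x => subd (F phi x) (G phi x)).
Proof. intros. unfold subd, rect_rectd, rect_extd. recsolve. Qed.

Local Open Scope R_scope.

Lemma rect_Some m (w : C) : rect m (Some w) <->
  (qval (nfst (nfst m)) < fst w < qval (nsnd (nfst m)) /\
   qval (nfst (nsnd m)) < snd w < qval (nsnd (nsnd m))).
Proof.
  unfold rect. rewrite (surjective_pairing (unpair m)).
  change (fst (unpair m)) with (nfst m). change (snd (unpair m)) with (nsnd m).
  rewrite (surjective_pairing (unpair (nfst m))), (surjective_pairing (unpair (nsnd m))).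
  reflexivity.
Qed.

Lemma rect_None m : ~ rect m None.
Proof.
  unfold rect. destruct (unpair m) as [m1 m2], (unpair m1), (unpair m2). easy.
Qed.

Lemma basic_eq n z : basic n z =
  match nfst n with 0%nat => rect (nsnd n) z | S _ => ext (nsnd n) z end.
Proof. unfold basic. now rewrite (surjective_pairing (unpair n)). Qed.

Lemma Cmod_gt_sq r (w : C) : 0 < r -> (r < Cmod w <-> r ^ 2 < fst w ^ 2 + snd w ^ 2).
Proof.
  intros Hr. unfold Cmod.
  assert (H0 : 0 <= fst w ^ 2 + snd w ^ 2) by nra.
  assert (E := sqrt_sqrt _ H0). assert (H1 := sqrt_pos (fst w ^ 2 + snd w ^ 2)).
  split; intros H; nra.
Qed.

Lemma subd_sound m k z : subd m k = 0%nat -> basic m z -> basic k z.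
Proof.
  rewrite !basic_eq. unfold subd, ifz.
  destruct (nfst m) as [|i], (nfst k) as [|j]; simpl natrec; intros E H.
  - destruct z as [w|]; [| now apply rect_None in H].
    apply rect_Some in H. apply rect_Some. unfold rect_rectd in E.
    apply Nat.eq_add_0 in E as [E1 E]. apply Nat.eq_add_0 in E as [E2 E].
    apply Nat.eq_add_0 in E as [E3 E4].
    apply (proj1 (qled_spec _ _)) in E1, E2, E3, E4. lra.
  - destruct z as [w|]; [| exact I]. apply rect_Some in H.
    set (a := nfst (nfst (nsnd m))) in *. set (b := nsnd (nfst (nsnd m))) in *.
    set (c := nfst (nsnd (nsnd m))) in *. set (d := nsnd (nsnd (nsnd m))) in *.
    unfold ext. fold (qval (nsnd k)). destruct (Rle_lt_dec (qval (nsnd k)) 0) as [Hr|Hr]; [now left |].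
    right. apply Cmod_gt_sq; auto. unfold rect_extd in E.
    (* The rectangle is open, so each coordinate exceeds a nonzero bound strictly. If both bounds
       are 0, the comparison contradicts the positivity of the radius. *)
    assert (Far : forall s t, 0 <= s -> 0 <= t -> (s = 0 \/ s < Rabs (fst w)) ->
      (t = 0 \/ t < Rabs (snd w)) -> Rmax (qval (nsnd k)) 0 ^ 2 <= s ^ 2 + t ^ 2 ->
      qval (nsnd k) ^ 2 < fst w ^ 2 + snd w ^ 2).
    { intros s t Hs Ht Hsx Hty. rewrite Rmax_left by lra. intros Hst.
      rewrite <- (pow2_abs (fst w)), <- (pow2_abs (snd w)).
      assert (0 <= Rabs (fst w)) by apply Rabs_pos. assert (0 <= Rabs (snd w)) by apply Rabs_pos.
      destruct Hsx as [-> | Hsx], Hty as [-> | Hty]; nra. }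
    assert (La : Rmax (qval a) 0 = 0 \/ Rmax (qval a) 0 < Rabs (fst w)).
    { unfold Rmax. destruct (Rle_dec (qval a) 0); [now left | right].
      apply Rlt_le_trans with (2 := Rle_abs _). lra. }
    assert (Lb : Rmax (- qval b) 0 = 0 \/ Rmax (- qval b) 0 < Rabs (fst w)).
    { unfold Rmax. destruct (Rle_dec (- qval b) 0); [now left | right].
      rewrite <- Rabs_Ropp. apply Rlt_le_trans with (2 := Rle_abs _). lra. }
    assert (Lc : Rmax (qval c) 0 = 0 \/ Rmax (qval c) 0 < Rabs (snd w)).
    { unfold Rmax. destruct (Rle_dec (qval c) 0); [now left | right].
      apply Rlt_le_trans with (2 := Rle_abs _). lra. }
    assert (Ld : Rmax (- qval d) 0 = 0 \/ Rmax (- qval d) 0 < Rabs (snd w)).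
    { unfold Rmax. destruct (Rle_dec (- qval d) 0); [now left | right].
      rewrite <- Rabs_Ropp. apply Rlt_le_trans with (2 := Rle_abs _). lra. }
    apply Nat.eq_mul_0 in E as [E|E].
    { exfalso. assert (Q := qplus_val (nsnd k)). rewrite E, Rmax_left in Q by lra.
      simpl in Q. lra. }
    apply Nat.eq_mul_0 in E as [E|E]; [| apply Nat.eq_mul_0 in E as [E|E];
      [| apply Nat.eq_mul_0 in E as [E|E]]];
    apply fard_spec in E; try apply qden_pos; rewrite ?qplus_val, ?qminus_val in E;
    eapply Far; try exact E; auto; apply Rmax_r.
  - discriminate.
  - apply (proj1 (qled_spec _ _)) in E. unfold qval in E. unfold ext in *.
    destruct z as [w|]; auto. lra.
Qed.

(** * Small rectangles pass the inclusion test *)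

Lemma qval_surj (z : Z) (n : nat) : exists u, qval u = IZR z / INR (S n).
Proof.
  assert (Hz : exists a, z_of_nat a = z).
  { destruct (Z.le_gt_cases 0 z) as [H|H].
    - exists (2 * Z.to_nat z)%nat. unfold z_of_nat.
      rewrite Nat.even_mul, Nat.div2_double. simpl. lia.
    - exists (S (2 * (Z.to_nat (- z) - 1)))%nat. unfold z_of_nat.
      rewrite Nat.even_succ, <- Nat.negb_even, Nat.even_mul, Nat.div2_succ_double. simpl. lia. }
  destruct Hz as [a <-]. exists (npair a n). unfold qval, q_of_nat.
  rewrite unpair_npair. unfold Q2R. simpl Qnum. simpl Qden.
  now rewrite Zpos_P_of_succ_nat, <- Nat2Z.inj_succ, <- INR_IZR_INZ.
Qed.

Lemma qval_dense x y : x < y -> exists u, x < qval u < y.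
Proof.
  intros H. destruct (INR_unbounded (/ (y - x))) as [n Hn].
  assert (Hn' : / (y - x) < INR (S n)) by (rewrite S_INR; lra).
  assert (P : 0 < / (y - x)) by (apply Rinv_0_lt_compat; lra).
  assert (Hd : 1 < (y - x) * INR (S n)).
  { replace 1 with ((y - x) * / (y - x)) by (field; lra). apply Rmult_lt_compat_l; lra. }
  destruct (archimed (x * INR (S n))) as [A1 A2].
  destruct (qval_surj (up (x * INR (S n))) n) as [u Hu]. exists u. rewrite Hu.
  split; [apply Rlt_div_r | apply Rlt_div_l]; lra.
Qed.

Definition near (w : C) (delta : R) (a b c d : nat) : Prop :=
  (fst w - delta < qval a < fst w /\ fst w < qval b < fst w + delta) /\
  (snd w - delta < qval c < snd w /\ snd w < qval d < snd w + delta).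

Definition rect_code (a b c d : nat) : nat := npair 0 (npair (npair a b) (npair c d)).

Lemma basic_rect_code a b c d (w : C) : basic (rect_code a b c d) (Some w) <->
  (qval a < fst w < qval b /\ qval c < snd w < qval d).
Proof.
  rewrite basic_eq. unfold rect_code. rewrite nfst_npair, nsnd_npair, rect_Some.
  now rewrite !nfst_npair, !nsnd_npair, !nfst_npair.
Qed.

Lemma near_exists w delta : 0 < delta -> exists a b c d, near w delta a b c d.
Proof.
  intros H.
  destruct (qval_dense (fst w - delta) (fst w)) as [a Ha]; [lra |].
  destruct (qval_dense (fst w) (fst w + delta)) as [b Hb]; [lra |].
  destruct (qval_dense (snd w - delta) (snd w)) as [c Hc]; [lra |].
  destruct (qval_dense (snd w) (snd w + delta)) as [d Hd]; [lra |].
  exists a, b, c, d. repeat split; lra.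
Qed.

(** This is [(x - delta) ^ 2] without its quadratic term. Being linear in [delta], the loss can
    later be matched to a given gap by one division. *)
Lemma Rmax_sq_ge x delta a : 0 <= x -> x - delta < a ->
  x ^ 2 - 2 * x * delta <= Rmax a 0 ^ 2.
Proof.
  intros Hx Ha. assert (M1 := Rmax_l a 0). assert (M2 := Rmax_r a 0).
  set (s := Rmax a 0) in *.
  destruct (Rle_lt_dec delta x) as [H|H].
  - assert ((x - delta) * (x - delta) <= s * s) by (apply Rmult_le_compat; lra).
    assert (0 <= delta * delta) by apply Rle_0_sqr. simpl. lra.
  - assert (0 <= x * (delta - x)) by (apply Rmult_le_pos; lra).
    assert (0 <= s * s) by apply Rle_0_sqr. assert (0 <= x * x) by apply Rle_0_sqr.
    simpl. lra.
Qed.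

Lemma coordinate_bound x delta a b :
  x - delta < qval a -> qval b < x + delta ->
  exists s, (s = Rmax (qval a) 0 \/ s = Rmax (- qval b) 0) /\
    x ^ 2 - 2 * Rabs x * delta <= s ^ 2.
Proof.
  intros Ha Hb. destruct (Rle_lt_dec 0 x) as [Hx|Hx].
  - exists (Rmax (qval a) 0). split; [now left |]. rewrite Rabs_pos_eq by lra.
    now apply Rmax_sq_ge.
  - exists (Rmax (- qval b) 0). split; [now right |]. rewrite Rabs_left by lra.
    replace (x ^ 2) with ((- x) ^ 2) by ring. apply Rmax_sq_ge; lra.
Qed.

Lemma subd_near k (w : C) : basic k (Some w) -> exists delta, 0 < delta /\
  forall a b c d, near w delta a b c d -> subd (rect_code a b c d) k = 0%nat.
Proof.
  rewrite basic_eq. unfold subd, rect_code. intros Hk.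
  destruct (nfst k) as [|j].
  - apply rect_Some in Hk as [[H1 H2] [H3 H4]].
    exists (Rmin (Rmin (fst w - qval (nfst (nfst (nsnd k)))) (qval (nsnd (nfst (nsnd k))) - fst w))
             (Rmin (snd w - qval (nfst (nsnd (nsnd k)))) (qval (nsnd (nsnd (nsnd k))) - snd w))).
    split; [repeat apply Rmin_glb_lt; lra |].
    intros a b c d. set (delta := Rmin _ _).
    assert (D1 : delta <= fst w - qval (nfst (nfst (nsnd k))))
      by (eapply Rle_trans; [apply Rmin_l | apply Rmin_l]).
    assert (D2 : delta <= qval (nsnd (nfst (nsnd k))) - fst w)
      by (eapply Rle_trans; [apply Rmin_l | apply Rmin_r]).
    assert (D3 : delta <= snd w - qval (nfst (nsnd (nsnd k))))
      by (eapply Rle_trans; [apply Rmin_r | apply Rmin_l]).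
    assert (D4 : delta <= qval (nsnd (nsnd (nsnd k))) - snd w)
      by (eapply Rle_trans; [apply Rmin_r | apply Rmin_r]).
    intros [[N1 N2] [N3 N4]]. rewrite nfst_npair, nsnd_npair. simpl ifz.
    unfold rect_rectd. rewrite !nfst_npair, !nsnd_npair, !nfst_npair.
    repeat (apply Nat.eq_add_0; split); apply qled_spec; lra.
  - unfold ext in Hk. fold (qval (nsnd k)) in Hk. set (r := qval (nsnd k)) in *.
    destruct (Rle_lt_dec r 0) as [Hr|Hr].
    + exists 1. split; [lra |]. intros a b c d _.
      rewrite nfst_npair, nsnd_npair. simpl ifz. unfold rect_extd.
      assert (Q := qplus_val (nsnd k)). fold r in Q. rewrite Rmax_right in Q by lra.
      assert (D := qden_pos (nsnd k)).
      replace (qplus (nsnd k)) with 0%nat; [reflexivity |].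
      apply INR_eq. simpl. apply Rmult_eq_compat_r with (r := INR (qden (nsnd k))) in Q.
      field_simplify in Q; lra.
    + destruct Hk as [Hk|Hk]; [lra |]. apply Cmod_gt_sq in Hk; auto.
      (* The two coordinate bounds together lose at most [delta * S], so [delta] is the gap between
         the squared modulus and [r ^ 2], divided by [S]; the summand 1 makes [S] positive at
         once. *)
      set (S := 2 * (Rabs (fst w) + Rabs (snd w)) + 1).
      assert (HS : 0 < S) by (unfold S; assert (H1 := Rabs_pos (fst w));
        assert (H2 := Rabs_pos (snd w)); lra).
      exists ((fst w ^ 2 + snd w ^ 2 - r ^ 2) / S). split; [apply Rdiv_lt_0_compat; lra |].
      intros a b c d. set (delta := _ / S).
      assert (Ed : delta * S = fst w ^ 2 + snd w ^ 2 - r ^ 2) by (unfold delta; field; lra).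
      assert (Pd : 0 < delta) by (apply Rdiv_lt_0_compat; lra).
      intros [[N1 N2] [N3 N4]].
      destruct (coordinate_bound (fst w) delta a b) as (s & Hs & Bs); try lra.
      destruct (coordinate_bound (snd w) delta c d) as (t & Ht & Bt); try lra.
      assert (Far : Rmax r 0 ^ 2 <= s ^ 2 + t ^ 2).
      { rewrite Rmax_left by lra. unfold S in Ed. lra. }
      rewrite nfst_npair, nsnd_npair. simpl ifz.
      rewrite !nfst_npair, !nsnd_npair, !nfst_npair.
      unfold rect_extd. rewrite !Nat.eq_mul_0, !fard_spec by apply qden_pos.
      rewrite !qplus_val, !qminus_val. fold r.
      destruct Hs as [-> | ->], Ht as [-> | ->]; tauto.
Qed.

(** Around a finite point the least of the finitely many radii works. At infinity all members are
    exteriors, and the one of largest radius is formally contained in the others. *)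
Lemma subd_base z (L : list nat) : (forall k, In k L -> basic k z) ->
  exists m, basic m z /\ forall k, In k L -> subd m k = 0%nat.
Proof.
  destruct z as [w|]; intros H.
  - assert (Hd : exists delta, 0 < delta /\ forall a b c d, near w delta a b c d ->
      forall k, In k L -> subd (rect_code a b c d) k = 0%nat).
    { induction L as [|k L IH].
      - exists 1. split; [lra |]. easy.
      - destruct IH as (d1 & P1 & H1); [intros; apply H; now right |].
        destruct (subd_near k w) as (d2 & P2 & H2); [apply H; now left |].
        exists (Rmin d1 d2). split; [now apply Rmin_glb_lt |].
        intros a b c d [[N1 N2] [N3 N4]] k' Hk'.
        assert (M1 := Rmin_l d1 d2). assert (M2 := Rmin_r d1 d2).
        destruct Hk' as [<-|Hk'].
        + apply H2. repeat split; lra.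
        + apply H1; auto. repeat split; lra. }
    destruct Hd as (delta & P & Hd).
    destruct (near_exists w delta P) as (a & b & c & d & N).
    exists (rect_code a b c d). split; [| now apply Hd].
    destruct N as [[N1 N2] [N3 N4]]. apply basic_rect_code. lra.
  - assert (Hm : exists u, forall k, In k L -> subd (npair 1 u) k = 0%nat).
    { assert (Hq : exists u, forall k, In k L -> qval (nsnd k) <= qval u).
      { clear H. induction L as [|k L [u IH]]; [exists 0%nat; easy |].
        destruct (Rle_lt_dec (qval (nsnd k)) (qval u)).
        - exists u. intros k' [<-|Hk']; auto.
        - exists (nsnd k). intros k' [<-|Hk']; [lra |]. specialize (IH _ Hk'). lra. }
      destruct Hq as [u Hu]. exists u. intros k Hk. specialize (Hu k Hk).
      specialize (H k Hk). rewrite basic_eq in H. unfold subd.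
      rewrite nfst_npair, nsnd_npair. destruct (nfst k) as [|j].
      - now apply rect_None in H.
      - now apply qled_spec. }
    destruct Hm as [u Hu]. exists (npair 1 u). split; auto.
    rewrite basic_eq, nfst_npair. exact I.
Qed.

(** * Compactness of the sphere *)

Lemma basic_ball k (w : C) : basic k (Some w) -> exists delta, 0 < delta /\
  forall v : C, Rabs (fst v - fst w) < delta -> Rabs (snd v - snd w) < delta ->
  basic k (Some v).
Proof.
  intros H. destruct (subd_near k w H) as (d0 & P0 & H0).
  destruct (near_exists w d0 P0) as (a & b & c & d & N).
  specialize (H0 a b c d N). destruct N as [[N1 N2] [N3 N4]].
  exists (Rmin (Rmin (fst w - qval a) (qval b - fst w)) (Rmin (snd w - qval c) (qval d - snd w))).
  split; [repeat apply Rmin_glb_lt; lra |].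
  intros v H1 H2. apply (subd_sound _ _ _ H0), basic_rect_code.
  apply Rabs_def2 in H1, H2.
  set (x1 := fst w - qval a) in *. set (x2 := qval b - fst w) in *.
  set (x3 := snd w - qval c) in *. set (x4 := qval d - snd w) in *.
  assert (A1 := Rmin_l (Rmin x1 x2) (Rmin x3 x4)).
  assert (A2 := Rmin_r (Rmin x1 x2) (Rmin x3 x4)).
  assert (B1 := Rmin_l x1 x2). assert (B2 := Rmin_r x1 x2).
  assert (B3 := Rmin_l x3 x4). assert (B4 := Rmin_r x3 x4).
  unfold x1, x2, x3, x4 in *. lra.
Qed.

Lemma sphere_compact (Good : nat -> Prop) :
  (forall z, exists k, Good k /\ basic k z) ->
  exists L, (forall k, In k L -> Good k) /\ forall z, exists k, In k L /\ basic k z.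
Proof.
  intros Cov. destruct (Cov None) as (k0 & G0 & B0).
  rewrite basic_eq in B0. destruct (nfst k0) as [|j] eqn:E0; [now apply rect_None in B0 |].
  (* Beyond [M] a single coordinate already exceeds the radius of [k0], the set covering infinity,
     so only a closed square remains to be covered. *)
  set (M := Rabs (qval (nsnd k0)) + 1).
  assert (Out : forall w : C, M < Rabs (fst w) \/ M < Rabs (snd w) -> basic k0 (Some w)).
  { intros w Hw. rewrite basic_eq, E0. unfold ext. fold (qval (nsnd k0)).
    destruct (Rle_lt_dec (qval (nsnd k0)) 0) as [Hr|Hr]; [now left | right].
    apply Cmod_gt_sq; auto. assert (A := Rle_abs (qval (nsnd k0))).
    rewrite <- (pow2_abs (fst w)), <- (pow2_abs (snd w)).
    assert (A1 := Rabs_pos (fst w)). assert (A2 := Rabs_pos (snd w)). unfold M in Hw.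
    destruct Hw; nra. }
  (* Each point of the plane gets a covering set and the size of a box inside it; choosing them by a
     function yields the gauge for [compactness_list]. *)
  assert (Ch : forall t : Tn 2 R, exists kd : nat * posreal, Good (fst kd) /\
    forall v : C, Rabs (fst v - fst t) < snd kd -> Rabs (snd v - fst (snd t)) < snd kd ->
    basic (fst kd) (Some v)).
  { intros t. destruct (Cov (Some (fst t, fst (snd t)))) as (k & G & B).
    destruct (basic_ball k _ B) as (delta & P & HB).
    exists (k, mkposreal delta P). split; [exact G | exact HB]. }
  pose (sel := fun t => proj1_sig (constructive_indefinite_description _ (Ch t))).
  assert (Hsel : forall t, Good (fst (sel t)) /\
    forall v : C, Rabs (fst v - fst t) < snd (sel t) ->
      Rabs (snd v - fst (snd t)) < snd (sel t) -> basic (fst (sel t)) (Some v))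
    by (intros t; exact (proj2_sig (constructive_indefinite_description _ (Ch t)))).
  (* [compactness_list] gives its finite list under a double negation. *)
  apply NNPP. intros No.
  apply (compactness_list 2 (- M, (- M, tt)) (M, (M, tt)) (fun t => snd (sel t))).
  intros [l Hl]. apply No. exists (k0 :: map (fun t => fst (sel t)) l). split.
  - intros k [<-|Hk]; auto. apply in_map_iff in Hk as (t & <- & _). apply Hsel.
  - intros [w|].
    + destruct (Rlt_le_dec M (Rabs (fst w))) as [H1|H1];
        [exists k0; split; [now left | auto] |].
      destruct (Rlt_le_dec M (Rabs (snd w))) as [H2|H2];
        [exists k0; split; [now left | auto] |].
      destruct (Hl (fst w, (snd w, tt))) as ((x & y & u) & Ht & _ & C1 & C2 & _).
      { apply Rabs_le_between in H1, H2. simpl. tauto. }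
      exists (fst (sel (x, (y, u)))).
      split; [right; now apply (in_map (fun t => fst (sel t))) | now apply Hsel].
    + exists k0. split; [now left |]. rewrite basic_eq, E0. exact B0.
Qed.

Lemma sphere_hausdorff z w : z <> w -> exists m n, basic m z /\ basic n w /\
  forall v, basic m v -> basic n v -> False.
Proof.
  assert (Inf : forall w : C, exists m n, basic m (Some w) /\ basic n None /\
    forall v, basic m v -> basic n v -> False).
  { clear z w. intros w. destruct (near_exists w 1 Rlt_0_1) as (a & b & c & d & [[N1 N2] [N3 N4]]).
    (* The rectangle stays within 1 of [w] in each coordinate, so its points have modulus less than
       this lower bound for the radius. *)
    destruct (qval_dense (Rabs (fst w) + Rabs (snd w) + 2) (Rabs (fst w) + Rabs (snd w) + 3))
      as [u Hu]; [lra |].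
    exists (rect_code a b c d), (npair 1 u). split; [apply basic_rect_code; lra |].
    split; [rewrite basic_eq, nfst_npair; exact I |].
    intros [v|] Hv; [| intros _; unfold rect_code in Hv; rewrite basic_eq, nfst_npair in Hv;
      now apply rect_None in Hv].
    apply basic_rect_code in Hv. rewrite basic_eq, nfst_npair, nsnd_npair. unfold ext.
    fold (qval u). assert (A1 := Rabs_pos (fst w)). assert (A2 := Rabs_pos (snd w)).
    intros [H|H]; [lra |]. apply Cmod_gt_sq in H; [| lra].
    rewrite <- (pow2_abs (fst v)), <- (pow2_abs (snd v)) in H.
    assert (B1 : Rabs (fst v) <= Rabs (fst w) + 1).
    { replace (fst v) with (fst w + (fst v - fst w)) by ring.
      eapply Rle_trans; [apply Rabs_triang |]. apply Rplus_le_compat_l, Rabs_le. lra. }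
    assert (B2 : Rabs (snd v) <= Rabs (snd w) + 1).
    { replace (snd v) with (snd w + (snd v - snd w)) by ring.
      eapply Rle_trans; [apply Rabs_triang |]. apply Rplus_le_compat_l, Rabs_le. lra. }
    assert (A3 := Rabs_pos (fst v)). assert (A4 := Rabs_pos (snd v)). nra. }
  destruct z as [z|], w as [w|]; intros D.
  (* A common point of the two rectangles would make each coordinate difference less than
     [2 * delta], and their sum less than itself. *)
  - set (delta := (Rabs (fst z - fst w) + Rabs (snd z - snd w)) / 4).
    assert (A1 := Rabs_pos (fst z - fst w)). assert (A2 := Rabs_pos (snd z - snd w)).
    assert (P : 0 < delta).
    { destruct (Rle_lt_dec delta 0) as [H|H]; [| exact H]. exfalso. apply D. f_equal.
      unfold delta in H. apply injective_projections.
      - apply Rminus_diag_uniq. destruct (Req_dec (fst z - fst w) 0) as [E|E]; auto.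
        apply Rabs_pos_lt in E. lra.
      - apply Rminus_diag_uniq. destruct (Req_dec (snd z - snd w) 0) as [E|E]; auto.
        apply Rabs_pos_lt in E. lra. }
    destruct (near_exists z delta P) as (a & b & c & d & [[N1 N2] [N3 N4]]).
    destruct (near_exists w delta P) as (a' & b' & c' & d' & [[N1' N2'] [N3' N4']]).
    exists (rect_code a b c d), (rect_code a' b' c' d').
    split; [apply basic_rect_code; lra |]. split; [apply basic_rect_code; lra |].
    intros [v|] Hv; [| intros _; unfold rect_code in Hv; rewrite basic_eq, nfst_npair in Hv;
      now apply rect_None in Hv].
    apply basic_rect_code in Hv. intros Hv'. apply basic_rect_code in Hv'.
    assert (B1 : Rabs (fst z - fst w) < 2 * delta) by (apply Rabs_def1; lra).
    assert (B2 : Rabs (snd z - snd w) < 2 * delta) by (apply Rabs_def1; lra).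
    unfold delta in *. lra.
  - apply Inf.
  - destruct (Inf w) as (m & n & Hm & Hn & H). exists n, m. repeat split; eauto.
  - congruence.
Qed.

(** The whole sphere is covered, not only [A]: points of [A] get neighbourhoods by continuity,
    points off [A] get neighbourhoods missing [A]. The finitely many matching neighbourhoods of [w]
    are then intersected. *)
Lemma image_closed (U A : Chat -> Prop) f :
  (forall z, U z -> cont_at_within U f z) -> closedS A -> (forall z, A z -> U z) ->
  closedS (image f A).
Proof.
  intros Hf HA HAU w Hw.
  pose (sep := fun k n => forall v, basic k v -> A v -> ~ basic n (f v)).
  assert (Cov : forall z, exists k, (exists n, basic n w /\ sep k n) /\ basic k z).
  { intros z. destruct (classic (A z)) as [Az|Az].
    - destruct (sphere_hausdorff (f z) w) as (m & n & Hm & Hn & D).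
      { intros E. apply Hw. now exists z. }
      destruct (Hf z (HAU z Az) m Hm) as (k & Hk & Ck).
      exists k. split; auto. exists n. split; auto.
      intros v Bv Av Bn. exact (D _ (Ck v Bv (HAU v Av)) Bn).
    - destruct (HA z Az) as (k & Hk & Ck).
      (* As [k] misses [A], any neighbourhood of [w] is separated from it; the empty list provides
         one. *)
      destruct (subd_base w []) as (n & Hn & _); [easy |].
      exists k. split; auto. exists n. split; auto.
      intros v Bv Av. now elim (Ck v Bv). }
  destruct (sphere_compact _ Cov) as (L & HL & HC).
  assert (HN : exists N, (forall n, In n N -> basic n w) /\
    forall k, In k L -> exists n, In n N /\ sep k n).
  { clear HC. induction L as [|k L IH]; [exists []; easy |].
    destruct IH as (N & H1 & H2); [intros; apply HL; now right |].
    destruct (HL k) as (n & Hn & Sn); [now left |].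
    exists (n :: N). split.
    - intros n' [<-|Hn']; auto.
    - intros k' [<-|Hk'].
      + exists n. split; [now left | exact Sn].
      + destruct (H2 k' Hk') as (n' & Hn' & Sn'). exists n'. split; [now right | exact Sn']. }
  destruct HN as (N & H1 & H2).
  destruct (subd_base w N H1) as (m & Hm & Hs).
  exists m. split; [exact Hm |].
  intros y By (z & Az & Ez). subst y.
  destruct (HC z) as (k & Hk & Bk). destruct (H2 k Hk) as (n & Hn & Sn).
  exact (Sn z Bk Az (subd_sound m n _ (Hs n Hn) By)).
Qed.

(** * The image machine *)

Local Open Scope nat_scope.

(** Padding entries impose no condition. Checking [s] positions is enough, as a list is not longer
    than its code. *)
Definition prefixd (m s : nat) : nat :=
  natrec s 0 (fun i r => r + natrec (lnth s i) 0 (fun k _ => subd m k)).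

Lemma prefixd_spec m s :
  prefixd m s = 0 <-> forall i k, lnth s i = S k -> subd m k = 0.
Proof.
  assert (Gen : forall n, natrec n 0 (fun i r => r + natrec (lnth s i) 0 (fun k _ => subd m k)) = 0
    <-> forall i k, i < n -> lnth s i = S k -> subd m k = 0).
  { induction n as [|n IH]; [split; [lia | reflexivity] |].
    simpl natrec. fold (natrec n 0 (fun i r => r + natrec (lnth s i) 0 (fun k _ => subd m k))).
    rewrite Nat.eq_add_0, IH. split.
    - intros [H1 H2] i k Hi E. destruct (Nat.eq_dec i n) as [->|D].
      + now rewrite E in H2.
      + apply (H1 i); auto. lia.
    - intros H. split; [intros i k Hi; apply H; lia |].
      destruct (lnth s n) as [|k] eqn:E; [reflexivity |].
      exact (H n k (Nat.lt_succ_diag_r n) E). }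
  unfold prefixd. rewrite Gen. split; intros H i k.
  - intros E. apply (H i k); auto. destruct (Nat.lt_ge_cases i s); auto.
    rewrite lnth_ge in E; easy.
  - intros _. apply H.
Qed.

Lemma recursive_prefixd F G : recursive F -> recursive G ->
  recursive (fun phi x => prefixd (F phi x) (G phi x)).
Proof.
  intros. unfold prefixd. apply recursive_natrec; [assumption | apply recursive_const |].
  cbv beta. apply recursive_add; [recsolve |].
  apply recursive_natrec; [| apply recursive_const | apply recursive_subd; recsolve].
  apply recursive_lnth; recsolve.
Qed.

(** In the joined oracle, odd cells carry the name of the closed set and cell 2 carries the machine
    code. A failed round prints 0, which is padding, so the stream stays total. *)
Definition image_stream (phi : nat -> nat) (x : nat) : nat :=
  natrec (phi (S (2 * nfst x))) 0 (fun m _ =>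
    ifz (prefixd m (nfst (nsnd x))) (sim_out phi (nfst (nsnd x)) (phi 2) (nsnd (nsnd x))) 0).

Lemma recursive_image_stream : recursive image_stream.
Proof.
  unfold image_stream. apply recursive_natrec; [recsolve | apply recursive_const |].
  cbv beta. apply recursive_ifz; [apply recursive_prefixd; recsolve | | apply recursive_const].
  apply recursive_sim_out; recsolve.
Qed.

Lemma image_stream_spec phi i s t v :
  image_stream phi (npair i (npair s t)) = S v <->
  exists m, phi (S (2 * i)) = S m /\ prefixd m s = 0 /\ sim_out phi s (phi 2) t = S v.
Proof.
  unfold image_stream. rewrite !nsnd_npair, !nfst_npair.
  destruct (phi (S (2 * i))) as [|m]; simpl natrec.
  - split; [easy | now intros (m & ? & _)].
  - unfold ifz. destruct (prefixd m s) as [|d] eqn:E; simpl natrec.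
    + split; [intros H; now exists m | now intros (m' & _ & _ & H)].
    + split; [easy |]. intros (m' & E1 & E2 & _). injection E1 as <-. congruence.
Qed.

Lemma even_double n : Nat.even (2 * n) = true.
Proof. now rewrite Nat.even_mul. Qed.

Lemma even_S_double n : Nat.even (S (2 * n)) = false.
Proof. now rewrite Nat.even_succ, <- Nat.negb_even, even_double. Qed.

Lemma join_double a b n : join a b (2 * n) = a n.
Proof. unfold join. now rewrite even_double, Nat.div2_double. Qed.

Lemma join_double_S a b n : join a b (S (2 * n)) = b n.
Proof. unfold join. now rewrite even_S_double, Nat.div2_succ_double. Qed.

Lemma double_or_S x : exists i, x = 2 * i \/ x = S (2 * i).
Proof. destruct (Nat.Even_or_Odd x) as [[i H]|[i H]]; exists i; lia. Qed.

(** The set [X] sits at even cells of the oracle of [f] and at multiples of 4 in the joined oracle;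
    this is the origin of the factor 2 in [sim_query]. *)
Lemma sim_query_double X e p s i :
  sim_query (join (join (char X) (fun _ => e)) p) s (2 * i) = char X i.
Proof.
  unfold sim_query. rewrite parity_spec, even_double. simpl ifz.
  change (join (join (char X) (fun _ => e)) p (2 * (2 * i)) = char X i).
  now rewrite !join_double.
Qed.

Lemma sim_query_double_S phi s i : sim_query phi s (S (2 * i)) = lnth s (S (2 * i)).
Proof. unfold sim_query. now rewrite parity_spec, even_S_double. Qed.

Lemma point_name_exists z : exists p, point_name z p.
Proof.
  exists (fun i => if excluded_middle_informative (basic i z) then S i else 0).
  intros k. split.
  - intros H. exists k. now destruct (excluded_middle_informative _).
  - intros [i E]. destruct (excluded_middle_informative (basic i z)); congruence.
Qed.

(** Names may repeat codes, so a full name can simply be appended after the prescribed entries. *)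
Lemma point_name_prefix z (a : nat -> nat) N :
  (forall i k, i < N -> a i = S k -> basic k z) ->
  exists p, point_name z p /\ forall i, i < N -> p i = a i.
Proof.
  intros Ha. destruct (point_name_exists z) as [p Hp].
  exists (fun i => if i <? N then a i else p (i - N)). split.
  - intros k. split.
    + intros H. apply Hp in H as [i Hi]. exists (N + i).
      destruct (Nat.ltb_spec (N + i) N); [lia |]. now rewrite Nat.add_comm, Nat.add_sub.
    + intros [i Hi]. destruct (Nat.ltb_spec i N); [eauto |]. apply Hp. eauto.
  - intros i Hi. now destruct (Nat.ltb_spec i N); [| lia].
Qed.

Theorem theorem2p9 :
  exists M : prog,
    forall (U : Chat -> Prop) (f : Chat -> Chat) (X : nat -> bool) (e : nat)
           (A : Chat -> Prop) (p : nat -> nat),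
      meromorphic U f ->
      fun_name U f X e ->
      closedS A ->
      (forall z, A z -> U z) ->
      closed_name A p ->
      closedS (image f A) /\
      exists q, computes M (join (join (char X) (fun _ => e)) p) q /\
                closed_name (image f A) q.
Proof.
  destruct (computes_of_recursive _ recursive_image_stream) as [M HM].
  exists M. intros U f X e A p [_ Hmer] Hf HA HAU Hp.
  split; [apply (image_closed U A f); auto; intros z Hz; apply Hmer, Hz |].
  set (phi := join (join (char X) (fun _ => e)) p).
  exists (image_stream phi). split; [apply HM |].
  assert (E2 : phi 2 = e) by reflexivity.
  intros v. split.
  - intros (w & (z & Az & <-) & Bv).
    destruct (point_name_exists z) as [p' Hp'].
    destruct (Hf z p' (HAU z Az) Hp') as (q & Hq & Hfq).
    apply Hfq in Bv as [k Ek]. destruct (Hq k) as [n En]. rewrite Ek in En.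
    destruct (run_sim_out _ _ _ _ _ En) as [N HN].
    (* The list is indexed by oracle cells, not by positions of the name. Its even entries are never
       read, and are set to 0 so that [prefixd] puts no condition on them. *)
    set (s := lcode (map (fun x => if Nat.even x then 0 else p' (Nat.div2 x)) (seq 0 N))).
    assert (Hs : forall x, lnth s x =
      if x <? N then if Nat.even x then 0 else p' (Nat.div2 x) else 0).
    { intros x. unfold s. rewrite lnth_lcode. destruct (Nat.ltb_spec x N) as [H|H].
      - rewrite (nth_indep _ 0 (if Nat.even 0 then 0 else p' (Nat.div2 0)))
          by now rewrite length_map, length_seq.
        rewrite (map_nth (fun x => if Nat.even x then 0 else p' (Nat.div2 x))).
        now rewrite seq_nth.
      - apply nth_overflow. now rewrite length_map, length_seq. }
    destruct (HN phi s) as [t Ht].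
    { intros x Hx. destruct (double_or_S x) as [i [->| ->]].
      - unfold phi. now rewrite sim_query_double, join_double.
      - rewrite sim_query_double_S, join_double_S, Hs.
        destruct (Nat.ltb_spec (S (2 * i)) N); [| lia].
        now rewrite even_S_double, Nat.div2_succ_double. }
    (* These are the codes listed by [s]: its nonzero entries, lowered by 1. They come from a name
       of [z], so they all contain [z]. *)
    assert (Hb : forall k, In k (map pred (filter (fun c => 0 <? c)
        (map (lnth s) (seq 0 N)))) -> basic k z).
    { intros k' H. apply in_map_iff in H as (c & <- & H). apply filter_In in H as [H Hc].
      apply in_map_iff in H as (x & <- & _). apply Hp'. revert Hc. rewrite Hs.
      destruct (x <? N); [| easy]. destruct (Nat.even x); [easy |]. intros Hc.
      apply Nat.ltb_lt in Hc. exists (Nat.div2 x). lia. }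
    destruct (subd_base z _ Hb) as (m & Bm & Hm).
    assert (Hpm : exists z, A z /\ basic m z) by eauto.
    apply Hp in Hpm as [i Hi].
    exists (npair i (npair s t)). apply image_stream_spec. exists m.
    split; [unfold phi; now rewrite join_double_S |]. split; [| now rewrite E2].
    apply prefixd_spec. intros x k' Ex. apply Hm. apply in_map_iff. exists (S k').
    split; [reflexivity |]. apply filter_In. split; [| reflexivity].
    rewrite <- Ex. apply in_map, in_seq. rewrite Hs in Ex.
    destruct (Nat.ltb_spec x N); [lia | easy].
  - intros [c Hc]. rewrite <- (npair_unpair c) in Hc.
    rewrite <- (npair_unpair (snd (unpair c))) in Hc.
    set (i := fst (unpair c)) in *. set (s := fst (unpair (snd (unpair c)))) in *.
    set (t := snd (unpair (snd (unpair c)))) in *.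
    apply image_stream_spec in Hc as (m & Hm & Hs & Ht). rewrite E2 in Ht.
    unfold phi in Hm. rewrite join_double_S in Hm.
    destruct (proj2 (Hp m)) as (z & Az & Bz); [now exists i |].
    exists (f z). split; [now exists z |].
    destruct (sim_out_run _ _ _ _ _ Ht) as [N HN].
    (* Only the odd entries of [s] are read by the simulation; they form the prefix. The zeros past
       the end of [s] put no condition on [z]. *)
    destruct (point_name_prefix z (fun i => lnth s (S (2 * i))) N) as (p' & Hp' & Ep').
    { intros j k _ E. apply (subd_sound m); auto.
      exact (proj1 (prefixd_spec m s) Hs _ _ E). }
    destruct (Hf z p' (HAU z Az) Hp') as (q & Hq & Hfq). apply Hfq.
    destruct (HN (join (char X) p')) as (n & k & En).
    { intros x Hx. destruct (double_or_S x) as [j [->| ->]].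
      - unfold phi. now rewrite sim_query_double, join_double.
      - rewrite sim_query_double_S, join_double_S. apply Ep'. lia. }
    exists k. destruct (Hq k) as [n' En'].
    (* The output only grows, so at the common time [n + n'] both entries at position [k] are
       present and must agree. *)
    apply (run_prefix _ _ n (n + n')) in En; [| lia].
    apply (run_prefix _ _ n' (n + n')) in En'; [| lia]. congruence.
Qed.
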